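(* Let $d$ be a positive integer. For every simple $2d$-regular graph $G$, the bipartite graph $G^*$ is also $2d$-regular, and the following are equivalent. 1. $G^*$ has a factor-of-iid proper edge $2d$-coloring. 2. $G^*$ has a factor-of-iid perfect matching. 3. $G^*$ has a factor-of-iid Schreier decoration. Moreover, if any of these is a finitary factor, the others are too (that is, if one of the three decorations exists as a finitary factor of iid, then so do the other two).
   Context: For a simple graph $G$ with all degrees even, $G^*$ is the simple graph with vertex set $\{x_e: e\in E(G)\}\cup\{v_i: v\in V(G),\ 1\le i\le \deg(v)/2\}$ and edge set $\{x_{uv}v_i : uv\in E(G),\ 1\le i\le\deg(v)/2\}$ (so each $x_{uv}$ is joined to all copies of both endpoints $u$ and $v$). A Schreier decoration of a $2d$-regular graph is a coloring of the edges with $d$ colors together with an orientation such that at every vertex there is exactly one incoming and exactly one outgoing edge of each color. For a graph $H$, let $\Gamma=\mathrm{Aut}(H)$ act on $[0,1]^{V(H)}$ by $(\gamma.f)(v)=f(\gamma^{-1}.v)$, and let $\mathtt{u}$ be Lebesgue measure on $[0,1]$. A factor-of-iid decoration of a given type (proper edge coloring, perfect matching, Schreier decoration) of $H$ is a measurable, $\Gamma$-equivariant map $\Phi$ from $([0,1]^{V(H)},\mathtt{u}^{V(H)})$ to the space of decorations of that type, where $\Phi$ is allowed to be undefined on a null set. $\Phi$ is finitary if for every vertex $x$ and almost every $\omega\in[0,1]^{V(H)}$ there is $R\in\mathbb{N}$ (possibly depending on $\omega$) such that the restriction of $\Phi(\omega)$ to the edges incident to $x$ is determined by $\omega|_{B_H(x,R)}$,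 i.e. it does not change if $\omega$ is changed outside the ball $B_H(x,R)$. *)

(* Defs.v *)
From HB Require Import structures.
From mathcomp Require Import all_boot all_order all_algebra.
From mathcomp Require Import all_classical all_reals all_analysis.

Set Implicit Arguments.
Unset Strict Implicit.
Unset Printing Implicit Defensive.

Local Open Scope classical_set_scope.
Local Open Scope card_scope.

(* No restriction on the cardinality of the vertex set, nor connectedness. *)
Record sgraph := SGraph {
  vertex :> Type;
  adj : vertex -> vertex -> Prop;
  adj_sym : forall u v, adj u v -> adj v u;
  adj_irrefl : forall v, ~ adj v v }.

Section Graph.
Variable G : sgraph.

Definition nbrs (v : G) : set G := [set u | adj v u].

Definition regular (k : nat) : Prop := forall v : G, nbrs v #= `I_k.

(* Meaningful when [nbrs v] is finite; the value is 0 otherwise. *)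
Definition deg (v : G) : nat := xget 0%N [set k | nbrs v #= `I_k].

Definition bipartite : Prop :=
  exists A : set G, forall u v : G, adj u v -> (A u <-> ~ A v).

Definition is_edge (e : set G) : Prop :=
  exists u v : G, adj u v /\ e = [set u; v].

Definition edge : Type := {e : set G | is_edge e}.

Definition incident (v : G) (e : edge) : Prop := sval e v.

Fixpoint gball (x : G) (r : nat) : set G :=
  if r is s.+1 then gball x s `|` [set z | exists2 y, gball x s y & adj y z]
  else [set x].

Record aut := Aut {
  aut_fun :> G -> G;
  aut_ifun : G -> G;
  aut_funK : cancel aut_fun aut_ifun;
  aut_ifunK : cancel aut_ifun aut_fun;
  aut_adj : forall u v, adj (aut_fun u) (aut_fun v) <-> adj u v }.

Lemma aut_inv_adj (g : aut) (u v : G) :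
  adj (aut_ifun g u) (aut_ifun g v) <-> adj u v.
Proof. by rewrite -(aut_adj g) !aut_ifunK. Qed.

Definition aut_inv (g : aut) : aut :=
  Aut (aut_ifunK g) (aut_funK g) (aut_inv_adj g).

Lemma aut_is_edge (g : aut) (e : edge) : is_edge (g @` sval e).
Proof.
case: e => _ /= [u [v [uv ->]]]; exists (g u), (g v); split.
  exact/aut_adj.
by rewrite image_setU !image_set1.
Qed.

Definition aut_edge (g : aut) (e : edge) : edge := exist _ _ (aut_is_edge g e).

End Graph.

Section Star.
Variable G : sgraph.

(* [inl e] is x_e, and [inr (existT v i)] is the copy v_i. *)
Definition star_vertex : Type := (edge G + {v : G & 'I_(deg v)./2})%type.

Definition star_adj (a b : star_vertex) : Prop :=
  match a, b with
  | inl e, inr w | inr w, inl e => incident (tag w) e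
  | _, _ => False
  end.

Lemma star_adj_sym a b : star_adj a b -> star_adj b a.
Proof. by case: a b => [e|w] [f|x]. Qed.

Lemma star_adj_irrefl a : ~ star_adj a a.
Proof. by case: a => [e|w] []. Qed.

Definition star : sgraph := SGraph star_adj_sym star_adj_irrefl.

End Star.

Section Decorations.
Variable H : sgraph.

(* A type of decorations: functions from the edges to [dvalue] satisfying
   [valid].  [dvalue_act] is the action of automorphisms on the values, needed
   for orientations, whose values mention vertices. *)
Record decoration_type := DecorationType {
  dvalue : Type;
  dvalue_act : aut H -> dvalue -> dvalue;
  valid : (edge H -> dvalue) -> Prop }.

Definition decoration_act (T : decoration_type) (g : aut H)
    (f : edge H -> dvalue T) : edge H -> dvalue T :=
  fun e => dvalue_act g (f (aut_edge (aut_inv g) e)).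

Definition is_proper_coloring (k : nat) (c : edge H -> 'I_k) : Prop :=
  forall (v : H) (e f : edge H),
    incident v e -> incident v f -> e <> f -> c e <> c f.

Definition proper_coloring (k : nat) : decoration_type :=
  DecorationType (fun=> id) (@is_proper_coloring k).

Definition is_perfect_matching (m : edge H -> bool) : Prop :=
  forall v : H, exists! e : edge H, m e /\ incident v e.

Definition perfect_matching : decoration_type :=
  DecorationType (fun=> id) is_perfect_matching.

(* [s e] is the color of e together with the endpoint to which e points. *)
Definition is_schreier (d : nat) (s : edge H -> 'I_d * H) : Prop :=
  (forall e : edge H, incident (s e).2 e) /\
  forall (v : H) (c : 'I_d),
    (exists! e : edge H, (s e).1 = c /\ (s e).2 = v) /\
    (exists! e : edge H, [/\ (s e).1 = c, incident v e & (s e).2 <> v]).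

Definition schreier (d : nat) : decoration_type :=
  DecorationType (fun (g : aut H) (x : 'I_d * H) => (x.1, g x.2))
    (@is_schreier d).

End Decorations.

Definition unit01 (R : realType) : Type := {i01 R}.
HB.instance Definition _ (R : realType) := Choice.on (unit01 R).
HB.instance Definition _ (R : realType) :=
  isPointed.Build (unit01 R) (0%:i01)%R.

Definition u01 (R : realType) (x : unit01 R) : R := (x%:num)%R.

Section FactorOfIID.
Variables (R : realType) (H : sgraph).

Definition cylinder : set (set (H -> unit01 R)) :=
  [set C | exists (v : H) (B : set R),
     measurable B /\ C = [set w | B (u01 (w v))]].

(* [0,1]^V(H) with its product sigma-algebra. *)
Definition labelling := g_sigma_algebraType cylinder.

(* This determines P uniquely, the finite-dimensional boxes being a pi-system
   generating the sigma-algebra: P is the product of the Lebesgue measures. *)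
Definition is_product_lebesgue (P : probability labelling R) : Prop :=
  forall (n : nat) (s : 'I_n -> H) (B : 'I_n -> set R),
    injective s -> (forall i, measurable (B i)) ->
    P [set w : labelling | forall i, B i (u01 (w (s i)))] =
    (\prod_(i < n) (@lebesgue_measure R) (B i `&` `[0%R, 1%R]))%E.

Definition labelling_act (g : aut H) (w : labelling) : labelling :=
  fun v => w (aut_inv g v).

Variables (P : probability labelling R) (T : decoration_type H).

(* The partial map is Phi restricted to its domain D.  Each coordinate of Phi
   takes finitely many values on D, hence arbitrary sets of values below. *)
Definition is_factor (D : set labelling)
    (Phi : labelling -> edge H -> dvalue T) : Prop :=
  [/\ measurable D /\ P (~` D) = 0%E,
      forall (e : edge H) (B : set (dvalue T)),
        measurable (D `&` [set w | B (Phi w e)]),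
      forall w, D w -> valid (Phi w)
    & forall (g : aut H) w, D w ->
        D (labelling_act g w) /\
        Phi (labelling_act g w) = decoration_act g (Phi w)].

Definition is_finitary (D : set labelling)
    (Phi : labelling -> edge H -> dvalue T) : Prop :=
  forall x : H, {ae P, forall w, D w ->
    exists r : nat, forall w', D w' ->
      (forall y, gball x r y -> w' y = w y) ->
      forall e : edge H, incident x e -> Phi w' e = Phi w e}.

Definition has_factor : Prop := exists D Phi, is_factor D Phi.

Definition has_finitary_factor : Prop :=
  exists D Phi, is_factor D Phi /\ is_finitary D Phi.

End FactorOfIID.

(* Main.v *)
From HB Require Import structures.
Require Import Defs.
From mathcomp Require Import all_boot all_order all_algebra.
From mathcomp Require Import all_classical all_reals all_analysis.
From mathcomp Require Import measurable_realfun finmap lra.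

(** Let H be the bipartite graph of edges x_e and vertex copies v_i.

A perfect matching of H lets every x_e choose one endpoint v of e and pairs
the d edges that chose v with the d copies of v.  So the edges of H split into
complete bipartite blocks K_{d,d}: the copies of v together with the d edges
that chose v, and the copies of v together with the other d edges at v.
If H is countable, its labels are almost surely distinct and rank both sides of
every block; giving color i + j mod d to the edge between the ranks i and j,
with separate palettes of d colors for the two kinds of block, is a proper
2d-coloring, because every vertex of H lies in exactly one block of each kind
([block_color_proper], [block_coloring_factor]).  In the other direction, in a
proper 2d-coloring of a 2d-regular graph every color class is a perfect
matching.

From a proper 2d-coloring, orient the edges with a color below d towards the
copies and the others away from them, and reduce the colors mod d: this is a
Schreier decoration.  From a Schreier decoration, the edges of one color that
point towards the copies form a perfect matching.  Both translations are made
edge by edge; they are equivariant as soon as automorphisms of H preserve the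
two sides.  For d > 1 they do, because the copies are exactly the vertices that
share their neighbourhood with another vertex ([aut_copy_side]).

All these rules read the given decoration and the order of the labels in a ball
of bounded radius, so they preserve measurability and finitariness
([local_rule_measurable], [local_rule_finitary]).

For d = 1 the graph H is a union of cycles and lines.  Matchings and proper
2-colorings still translate edge by edge ([coloring_of_matching_valid]), but an
automorphism may exchange the sides, so that a matching does not determine an
orientation equivariantly.  Instead, either of them makes H countable with
finite components ([orientation_factor_rigid]).  Indeed the reflection of a component about one
of its vertices preserves the sides and reverses every coherent orientation.
On a line one can reflect about vertices arbitrarily far away, and no event is
exchanged with its complement by symmetries that move any given finite set off
itself ([no_antisymmetric_event]).  Conversely, if H is countable with finite
components, orienting every component from its vertex of largest label towards
the neighbour with the larger label gives a finitary Schreier decoration, and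
the alternating matching that contains this first edge is a finitary perfect
matching ([top_schreier_finitary_factor], [top_matching_finitary_factor]).

The graph may be uncountable, and then ties cannot be avoided almost surely.
But a measurable domain constrains only countably many labels, so in an
uncountable graph it contains a labelling invariant under a swap of two copies
of one vertex, or under the reflection of one component, and no matching or
orientation is invariant under these ([matching_factor_countable],
[orientation_factor_countable]). *)

Set Implicit Arguments.
Unset Strict Implicit.
Unset Printing Implicit Defensive.

Import Order.TTheory GRing.Theory Num.Theory.
Local Open Scope classical_set_scope.
Local Open Scope card_scope.
Local Open Scope ring_scope.

(** * Labellings and permutations of the vertices *)

Section Labellings.
Variables (R : realType) (H : sgraph).
Local Notation L := (labelling R H).

Lemma measurable_cylinder (v : H) (B : set R) :
  measurable B -> measurable [set w : L | B (u01 (w v))].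
Proof. by move=> mB; apply: sub_sigma_algebra; exists v, B. Qed.

Lemma measurable_label (v : H) : measurable_fun setT (fun w : L => u01 (w v)).
Proof. by move=> _ B mB; rewrite setTI; exact: measurable_cylinder. Qed.

(** The sigma-algebra of labellings is only known through its generators, so
facts about all events are proved by closure under its operations. *)
Lemma measurable_labelling_ind (Q : set (set L)) :
  Q set0 -> (forall A, Q A -> Q (~` A)) ->
  (forall A : (set L)^nat, (forall n, Q (A n)) -> Q (\bigcup_n A n)) ->
  (forall (v : H) (B : set R), measurable B -> Q [set w | B (u01 (w v))]) ->
  forall E : set L, measurable E -> Q E.
Proof.
move=> Q0 QC QU Qcyl; apply: smallest_sub => [|_ [v [B [mB ->]]]]; last exact: Qcyl.
by split=> // A QA; rewrite setTD; exact: QC.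
Qed.

Definition depends_on (S : set H) (E : set L) :=
  forall w w' : L, (forall v, S v -> w v = w' v) -> E w -> E w'.

Lemma depends_onC S E : depends_on S E -> depends_on S (~` E).
Proof. by move=> dE w w' ww' nE Ew'; apply/nE/(dE _ _ _ Ew') => v /ww'. Qed.

(** Cylinders look at one vertex, and a countable union looks at countably
many vertices if each of its members does. *)
Lemma measurable_depends_on_countable (E : set L) :
  measurable E -> exists2 S, countable S & depends_on S E.
Proof.
move: E; apply: measurable_labelling_ind.
- by exists set0.
- by move=> A [S cS dA]; exists S => //; exact: depends_onC.
- move=> A /(_ _)/cid2-/all_sig2[S cS dA].
  exists (\bigcup_n S n); first exact: bigcup_countable.
  move=> w w' ww' [n _ Anw]; exists n => //; apply: dA Anw => v Sv.
  by apply: ww'; exists n.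
- move=> v B _; exists [set v]; first exact: countable1.
  by move=> w w' /(_ v erefl) /= ->.
Qed.

Definition relabel (p : H -> H) (w : L) : L := fun v => w (p v).

Lemma measurable_relabel p : measurable_fun setT (relabel p).
Proof.
move=> _ E mE; rewrite setTI; move: E mE; apply: measurable_labelling_ind.
- by rewrite preimage_set0.
- by move=> A mA; rewrite -preimage_setC; exact: measurableC.
- by move=> A mA; rewrite preimage_bigcup; exact: bigcupT_measurable.
- by move=> v B mB; exact: (measurable_cylinder (p v)).
Qed.

Lemma measurable_relabel_preimage p (E : set L) :
  measurable E -> measurable (relabel p @^-1` E).
Proof. by move=> mE; rewrite -[X in measurable X]setTI; exact: measurable_relabel. Qed.

Lemma finite_set_enum (T : Type) (F : set T) : finite_set F ->
  exists (n : nat) (s : 'I_n -> T), injective s /\ range s = F.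
Proof.
elim/Pchoice: T F => T F /finite_fsetP[X ->].
exists #|` X|, (tnth (in_tuple (enum_fset X))); split.
  by apply/tuple_uniqP; exact: fset_uniq.
apply/seteqP; split=> [_ [i _ <-]|x /= xX]; first exact: mem_tnth.
by have /tnthP[i ->] : x \in in_tuple (enum_fset X) by []; exists i.
Qed.

(** One side per vertex, all but finitely many of them trivial: in this form
the intersection of two boxes is taken vertex by vertex. *)
Definition box : set (set L) :=
  [set E | exists B : H -> set R, [/\ forall v, measurable (B v),
     finite_set [set v | B v <> setT] & E = [set w : L | forall v, B v (u01 (w v))]]].

Lemma box_setI : setI_closed box.
Proof.
move=> _ _ [B [mB fB ->]] [C [mC fC ->]]; exists (fun v => B v `&` C v); split.
- by move=> v; exact: measurableI.
- apply: sub_finite_set (_ : finite_set ([set v | B v <> setT] `|` [set v | C v <> setT])).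
    move=> v /= BC; have [BT|] := pselect (B v = setT); last by left.
    by right=> CT; apply: BC; rewrite BT CT setTI.
  by rewrite finite_setU.
- apply/seteqP; split=> w /= => [[Bw Cw] v|BCw]; first by split.
  by split=> v; case: (BCw v).
Qed.

Lemma boxE (B : H -> set R) n (s : 'I_n -> H) :
  range s = [set v | B v <> setT] ->
  [set w : L | forall v, B v (u01 (w v))] =
  [set w : L | forall i, B (s i) (u01 (w (s i)))].
Proof.
move=> sB; apply/seteqP; split=> w //= Bw v.
have [->//|] := pselect (B v = setT); rewrite -[X in X -> _]/([set v | B v <> setT] v) -sB.
by move=> [i _ <-].
Qed.

Lemma box_measurable : box `<=` @measurable _ L.
Proof.
move=> _ [B [mB /finite_set_enum[n [s [_ sB]]] ->]]; rewrite (boxE sB).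
rewrite [X in measurable X](_ : _ = \bigcap_(i in [set: 'I_n])
    [set w : L | B (s i) (u01 (w (s i)))]).
  apply: fin_bigcap_measurable => // i _; exact: measurable_cylinder.
by apply/seteqP; split=> w /= Bw i; [move=> _|exact: (Bw i)].
Qed.

Variables (P : probability L R) (hP : is_product_lebesgue P).

(** A relabelled box has the same sides at other vertices, and the measure of
a box depends only on its sides; boxes form a pi-system generating the events. *)
Lemma measure_relabel (p : H -> H) (E : set L) : injective p ->
  measurable E -> P (relabel p @^-1` E) = P E.
Proof.
move=> pinj mE; apply/esym.
pose m2 : {measure set L -> \bar R} :=
  measure_function_pushforward__canonical__measure_function_Measure P (measurable_relabel p).
rewrite -[RHS]/(m2 E).
apply: (@g_sigma_algebra_measure_unique _ _ _ box box_measurable (fun=> setT)).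
- move=> _; exists (fun=> setT); split=> //.
    by rewrite [X in finite_set X](_ : _ = set0)//; apply/seteqP; split.
  by apply/seteqP; split.
- by rewrite bigcup_const//; exists 0%N.
- exact: box_setI.
- move=> _ [B [mB /finite_set_enum[n [s [sinj sB]]] ->]].
  rewrite (boxE sB).
  apply: etrans (hP sinj (fun i => mB (s i))) _; apply/esym.
  exact: (hP (inj_comp pinj sinj) (fun i => mB (s i))).
- by move=> k; exact: le_lt_trans (probability_le1 P measurableT) (ltry 1).
- apply: smallest_sub mE => [|_ [v [B [mB ->]]]]; first exact: smallest_sigma_algebra.
  apply: sub_sigma_algebra; exists (fun u => if pselect (u = v) then B else setT); split.
  + move=> u; case: (pselect (u = v)) => [uv|uv]; [exact: mB|exact: measurableT].
  + apply: sub_finite_set (finite_set1 v) => u /=.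
    by case: pselect => // uv /(_ erefl).
  + apply/seteqP; split=> w /= Bw.
      by move=> u; case: (pselect (u = v)) => [uv|//] /=; rewrite uv.
    by move: (Bw v); case: (pselect (v = v)).
Qed.
End Labellings.

(** * Finite tests and ties *)

(** Splitting [Q] according to the answer to the first test leaves two sets
saturated for the remaining tests; with no test left, a saturated set is empty
or all of [D]. *)
Lemma measurable_saturated d (T : measurableType d) (I : eqType) (D : set T)
    (t : I -> set T) (s : seq I) (Q : set T) :
  measurable D -> (forall i, measurable (D `&` t i)) -> Q `<=` D ->
  (forall w w', Q w -> D w' -> (forall i, i \in s -> t i w <-> t i w') -> Q w') ->
  measurable Q.
Proof.
move=> mD mt; elim: s Q => [|i s IHs] Q QD sat.
  have [->|/set0P[w Qw]] := eqVneq Q set0; first exact: measurable0.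
  suff -> : Q = D by [].
  by apply/seteqP; split=> // w' Dw'; apply: sat Qw Dw' _.
pose Qb (b : Prop) := [set w' | D w' /\ exists w, [/\ Q w, t i w <-> b &
  forall j, j \in s -> t j w <-> t j w']].
have mQb b : measurable (Qb b).
  apply: IHs => [w [] //|w w' [Dw [w0 [Qw0 tib ts]]] Dw' ww']; split=> //.
  by exists w0; split=> // j js; rewrite ts// ww'.
rewrite (_ : Q = (Qb True `&` (D `&` t i)) `|` (Qb False `\` (D `&` t i))).
  by apply: measurableU; [exact: measurableI|exact: measurableD].
apply/seteqP; split=> [w Qw|w'].
  have Dw := QD _ Qw.
  have [tiw|tiw] := pselect (t i w); [left|right]; split=> //.
  - by split=> //; exists w; split.
  - by split=> //; exists w; split.
  - by case.
case=> [[[Dw' [w [Qw tib ts]]] [_ tiw]]|[[Dw' [w [Qw tib ts]]] ntiw]].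
  apply: sat Qw Dw' _ => j; rewrite inE => /predU1P[->|/ts//]; tauto.
apply: (sat _ _ Qw (Dw')) => j; rewrite inE => /predU1P[->|/ts//].
split=> [/tib[]|tiw'].
  by case: ntiw; split.
Qed.

(** This is what makes arbitrary sets of values [B] harmless: a decoration read
off finitely many yes/no questions takes each value on a measurable set. *)
Lemma measurable_finite_tests d (T : measurableType d) (I X : Type) (D : set T)
    (t : I -> set T) (F : set I) (f : T -> X) :
  measurable D -> finite_set F -> (forall i, measurable (D `&` t i)) ->
  (forall w w', D w -> D w' -> (forall i, F i -> t i w <-> t i w') -> f w = f w') ->
  forall B : set X, measurable (D `&` [set w | B (f w)]).
Proof.
move=> mD /finite_set_enum[n [s [_ <-]]] mt ft B.
apply: (@measurable_saturated _ _ 'I_n D (t \o s) (enum 'I_n)) => //.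
  by move=> i; exact: mt.
move=> w w' [Dw Bw] Dw' ww'; split=> //=.
rewrite -(ft w)// => _ [i _ <-]; apply: ww'; exact: mem_enum.
Qed.

Section Ties.
Variables (R : realType) (H : sgraph).
Local Notation L := (labelling R H).

Lemma measurable_label_lt (a b : H) :
  measurable [set w : L | u01 (w a) < u01 (w b)].
Proof.
have := measurable_fun_ltr (measurable_label a) (measurable_label b).
by move=> /(_ R measurableT [set true] I); rewrite setTI.
Qed.

Lemma u01_inj : injective (@u01 R).
Proof. exact: val_inj. Qed.

Lemma measurable_tie (a b : H) : measurable [set w : L | w a = w b].
Proof.
rewrite (_ : [set w : L | w a = w b] =
  ~` ([set w : L | u01 (w a) < u01 (w b)] `|` [set w : L | u01 (w b) < u01 (w a)])).
  by apply: measurableC; apply: measurableU; exact: measurable_label_lt.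
apply/seteqP; split=> w /=; first by move=> ->; rewrite ltxx => -[].
move=> /not_orP[/negP + /negP]; rewrite -!leNgt => ba ab.
by apply: u01_inj; apply/eqP; rewrite eq_le ab.
Qed.

Variables (P : probability L R) (hP : is_product_lebesgue P).

Lemma u01_ge0 (x : unit01 R) : 0 <= u01 x.
Proof. by rewrite /u01. Qed.
Lemma u01_le1 (x : unit01 R) : u01 x <= 1.
Proof. by rewrite /u01. Qed.

(** The square diagonal is covered by n + 1 boxes of side 1 / (n + 1), so a
tie has probability at most 1 / (n + 1). *)
Lemma tie_null (a b : H) : a <> b -> P [set w : L | w a = w b] = 0%E.
Proof.
move=> ab.
(* The boxes [K n i], for i < n + 1, cover the diagonal. *)
pose J (n i : nat) : set R := `[i%:R / n.+1%:R, i.+1%:R / n.+1%:R]%classic.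
pose K n i := [set w : L | J n i (u01 (w a)) /\ J n i (u01 (w b))].
have JE n i : (i < n.+1)%N -> lebesgue_measure (J n i `&` `[0, 1]%classic) = (n.+1%:R^-1)%:E.
  move=> ilt; rewrite setIidl; last first.
    move=> x; rewrite /J /= !in_itv /= => /andP[ix xi]; apply/andP; split.
      by apply: le_trans ix; rewrite divr_ge0.
    by apply: le_trans xi _; rewrite ler_pdivrMr ?ltr0n// mul1r ler_nat.
  rewrite lebesgue_measure_itv/= lte_fin ltr_pM2r ?invr_gt0 ?ltr0n// ltr_nat ltnSn.
  by rewrite -EFinB -mulrBl -natrB// subSnn mul1r.
have mJ n i : measurable (J n i) by exact: measurable_itv.
have PK n i : (i < n.+1)%N -> P (K n i) = (n.+1%:R^-1 ^+ 2)%:E.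
  move=> ilt; pose s (k : 'I_2) := if k == 0%N :> nat then a else b.
  have sinj : injective s.
    by move=> [[|[|//]] ?] [[|[|//]] ?]; rewrite /s /= => e; apply/val_inj => //=;
       exfalso; apply: ab.
  have := hP sinj (fun=> mJ n i); rewrite big_ord_recl big_ord1/= JE// -EFinM -expr2 => <-.
  congr (P _); apply/seteqP; split=> w /=; first by case=> ? ? [[|[|//]] ?].
  move=> e; split; first exact: (e ord0).
  exact: (e (lift ord0 ord0)).
have mK n i : measurable (K n i).
  by apply: measurableI; exact: measurable_cylinder.
have tieK n : [set w : L | w a = w b] `<=` \big[setU/set0]_(i < n.+1) K n i.
  move=> w /= wab; rewrite -bigcup_mkord.
  have n0 : (0 : R) < n.+1%:R by rewrite ltr0n.
  pose x := u01 (w a) * n.+1%:R.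
  have x0 : 0 <= x by rewrite mulr_ge0 ?u01_ge0.
  have xn : x <= n.+1%:R by rewrite ler_piMl ?u01_le1// ltW.
  suff [i ilt /andP[ix xi]] : exists2 i, (i < n.+1)%N & i%:R <= x <= i.+1%:R.
    exists i => //; rewrite /K /= -wab /J /= in_itv/=.
    by rewrite ler_pdivrMr// ler_pdivlMr// ix xi.
  have [xn1|nx] := ltP x n.+1%:R.
    exists (Num.truncn x); first by rewrite truncn_lt_nat.
    by have /andP[-> /ltW] := truncn_itv x0.
  by exists n => //; rewrite xn andbT (le_trans _ nx)// ler_nat.
have Pn n : (P [set w : L | w a = w b] <= (n.+1%:R^-1)%:E)%E.
  have PU : (P [set w : L | w a = w b] <= P (\big[setU/set0]_(i < n.+1) K n i))%E.
    have mU : measurable (\big[setU/set0]_(i < n.+1) K n i).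
      by apply: bigsetU_measurable => i _; exact: mK.
    exact: (le_measure P (mem_set (measurable_tie a b)) (mem_set mU) (tieK n)).
  apply: (le_trans PU); apply: le_trans (Boole_inequality _ _) _ => [i _|]; first exact: mK.
  rewrite (eq_bigr (fun=> (n.+1%:R^-1 ^+ 2)%:E)); last by move=> i _; exact: PK.
  rewrite sumEFin lee_fin sumr_const card_ord -(mulr_natr (_ ^+ 2)) expr2 -mulrA.
  by rewrite mulVf ?mulr1// pnatr_eq0.
apply/eqP; rewrite eq_le measure_ge0 andbT.
apply/lee_addgt0Pr => e e0; rewrite add0e.
have [n _ /(_ n (leqnn n))] := near_infty_natSinv_lt (PosNum e0).
by move=> /= ne; apply: le_trans (Pn n) _; rewrite lee_fin ltW.
Qed.

End Ties.

(** A countable index set of any type is listed by natural numbers, each number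
standing for at most one index. *)
Lemma measurable_bigcup_countable d (T : measurableType d) (I : Type) (S : set I)
    (F : I -> set T) :
  countable S -> (forall i, S i -> measurable (F i)) ->
  measurable (\bigcup_(i in S) F i).
Proof.
move=> /countable_injP[f finj] mF.
rewrite (_ : \bigcup_(i in S) F i =
             \bigcup_n \bigcup_(i in [set i | S i /\ f i = n]) F i); last first.
  apply/seteqP; split=> [w [i Si Fiw]|w [n _ [i [Si _] Fiw]]]; last by exists i.
  by exists (f i) => //; exists i.
apply: bigcupT_measurable => n.
have [[i [Si fin]]|none] := pselect (exists i, S i /\ f i = n).
  rewrite (_ : [set i | S i /\ f i = n] = [set i]).
    by rewrite bigcup_set1; exact: mF.
  apply/seteqP; split=> [j [Sj fjn]|_ ->//].
  by apply: finj; [exact: mem_set|exact: mem_set|rewrite fjn].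
rewrite (_ : [set i | S i /\ f i = n] = set0); first by rewrite bigcup_set0.
by apply/seteqP; split=> // i Sfi; apply: none; exists i.
Qed.

Lemma ae_countable d (T : measurableType d) (R : realType)
    (mu : {measure set T -> \bar R}) (I : Type) (S : set I) (A : I -> T -> Prop) :
  countable S -> (forall i, S i -> {ae mu, forall w, A i w}) ->
  {ae mu, forall w, forall i, S i -> A i w}.
Proof.
move=> /countable_injP[f finj] aeA.
have : {ae mu, forall w, forall n, forall i, S i -> f i = n -> A i w}.
  apply: ae_foralln => n.
  have [[i [Si fin]]|none] := pselect (exists i, S i /\ f i = n).
    apply: filterS (aeA i Si) => w Aiw j Sj fjn.
    suff -> : j = i by [].
    by apply: finj; [exact: mem_set|exact: mem_set|rewrite fjn].
  by apply: aeW => w i Si fin; case: none; exists i.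
by apply: filterS => w Aw i Si; exact: (Aw (f i)).
Qed.

Section AlmostSure.
Variables (R : realType) (H : sgraph).
Local Notation L := (labelling R H).
Variables (P : probability L R) (hP : is_product_lebesgue P).

Definition tieless : set L := [set w | injective w].

(** A countable graph has countably many pairs of vertices, each tied with
probability zero. *)
Lemma tieless_full : countable [set: H] ->
  measurable tieless /\ P (~` tieless) = 0%E.
Proof.
move=> cH.
have cHH : countable ([set: H] `*` [set: H]) by exact: countableX.
have tieE : ~` tieless = \bigcup_(ab in [set ab : H * H | ab.1 <> ab.2])
    [set w : L | w ab.1 = w ab.2].
  apply/seteqP; split=> [w|w [[a b] /= ab wab] inj]; last exact/ab/inj.
  move=> /existsNP[a /existsNP[b /not_implyP[wab ab]]].
  by exists (a, b).
have cS : countable [set ab : H * H | ab.1 <> ab.2].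
  by apply: sub_countable cHH; exact: subset_card_le.
have mties : measurable (~` tieless).
  rewrite tieE; apply: measurable_bigcup_countable => // ab _; exact: measurable_tie.
split; first by rewrite -[tieless]setCK; exact: measurableC.
apply/negligibleP => //.
have : {ae P, forall w, forall ab : H * H, ab.1 <> ab.2 -> w ab.1 <> w ab.2}.
  apply: (ae_countable (S := [set ab : H * H | ab.1 <> ab.2])) => // -[a b] /= ab.
  exists [set w : L | w a = w b]; split; first exact: measurable_tie.
    exact: tie_null.
  by move=> w /= /contrapT.
apply: negligibleS => w; rewrite tieE => -[ab abn wab] /(_ ab abn); exact.
Qed.

Local Open Scope ereal_scope.

(** * Finite-dimensional approximation and events exchanged with their complement *)

Lemma prob_le (A B : set L) : measurable A -> measurable B -> A `<=` B -> P A <= P B.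
Proof. by move=> mA mB; apply: le_measure; exact: mem_set. Qed.

Lemma prob_subU (A B C : set L) : measurable A -> measurable B ->
  measurable C -> C `<=` A `|` B -> P C <= P A + P B.
Proof.
move=> mA mB mC CAB; apply: (le_trans (prob_le mC (measurableU _ _ mA mB) CAB)).
exact: (measureU2 P mA mB).
Qed.

Lemma probU_lt (A B C : set L) (a b : R) : measurable A -> measurable B ->
  measurable C -> C `<=` A `|` B -> P A < a%:E -> P B < b%:E -> P C < (a + b)%:E.
Proof.
move=> mA mB mC CAB PA PB; apply: (le_lt_trans (prob_subU mA mB mC CAB)).
by rewrite EFinD; exact: lteD.
Qed.

Definition sdiff (A B : set L) := (A `\` B) `|` (B `\` A).

Definition approximable (E : set L) := forall e : R, (0 < e)%R ->
  exists F C, [/\ finite_set F, measurable C, depends_on F C & P (sdiff C E) < e%:E].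

Lemma measurable_sdiff A B : measurable A -> measurable B -> measurable (sdiff A B).
Proof. by move=> mA mB; apply: measurableU; exact: measurableD. Qed.

(** The approximable events form a sigma-algebra: a countable union is first
replaced by a finite one, which loses little measure by continuity. *)
Lemma approximable_measurable E : measurable E -> approximable E.
Proof.
move=> mE; suff: measurable E /\ approximable E by case.
move: E mE; apply: measurable_labelling_ind.
- split=> [|e e0]; first exact: measurable0.
  exists set0, set0; split; [exact: finite_set0|exact: measurable0|by []|].
  by rewrite /sdiff setDv setU0 measure0 lte_fin.
- move=> A [mA apA]; split=> [|e /apA[F [C [fF mC dC CA]]]]; first exact: measurableC.
  exists F, (~` C); split=> //; [exact: measurableC|exact: depends_onC|].
  rewrite (_ : sdiff _ _ = sdiff C A)//; apply/seteqP.
  by split=> w; rewrite /sdiff /setD /setC /=;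
    have [?|?] := pselect (A w); have [?|?] := pselect (C w); tauto.
- move=> A hA; have mA n : measurable (A n) by case: (hA n).
  have mU : measurable (\bigcup_n A n) by exact: bigcupT_measurable.
  split=> [//|e e0].
  pose U n := \big[setU/set0]_(i < n) A i.
  have mUn n : measurable (U n) by exact: bigsetU_measurable.
  have e20 : (0 < e / 2)%R by rewrite divr_gt0.
  have apU n : approximable (U n).
    elim: n => [|n IHn] d d0.
      exists set0, set0; split; [exact: finite_set0|exact: measurable0|by []|].
      by rewrite /U big_ord0 /sdiff setDv setU0 measure0 lte_fin.
    have d20 : (0 < d / 2)%R by rewrite divr_gt0.
    have [F [C [fF mC dC PC]]] := IHn _ d20.
    have [F' [C' [fF' mC' dC' PC']]] := (hA n).2 _ d20.
    exists (F `|` F'), (C `|` C'); split; [by rewrite finite_setU|exact: measurableU| |].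
      by move=> w w' ww' [/dC Cw|/dC' Cw]; [left; apply: Cw|right; apply: Cw] => v Fv;
        apply: ww'; [left|right].
    rewrite (splitr d); apply: probU_lt PC PC'; try exact: measurable_sdiff.
      by apply: measurable_sdiff => //; exact: measurableU.
    rewrite /U big_ord_recr/= -/(U n) => w; rewrite /sdiff /setD /setU /=; tauto.
  pose V n := (\bigcup_n A n) `\` U n.
  have mV n : measurable (V n) by exact: measurableD.
  have V0 : \bigcap_n V n = set0.
    apply/seteqP; split=> // w Vw; have [[n _ Anw] _] := Vw 0%N I.
    by have [_] := Vw n.+1 I; apply; rewrite /U -bigcup_mkord; exists n => /=.
  have : (P \o V) @ \oo --> P (\bigcap_n V n).
    apply: nonincreasing_cvg_mu => //.
    + exact: le_lt_trans (probability_le1 P (mV 0%N)) (ltry 1).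
    + by rewrite V0; exact: measurable0.
    + move=> m n mn; apply/subsetPset; apply: setDS; rewrite /U -!bigcup_mkord.
      by move=> w [i im Aiw]; exists i => //; exact: leq_trans mn.
  rewrite V0 measure0 => /fine_cvgP[_ /cvgr_lt/(_ _ e20)[n _ /(_ n (leqnn n))/= Pn]].
  have {}Pn : P (V n) < (e / 2)%:E by rewrite -(fineK (fin_num_measure P _ (mV n))) lte_fin.
  have [F [C [fF mC dC PC]]] := apU n _ e20.
  exists F, C; split=> //; rewrite (splitr e); apply: probU_lt PC Pn.
  + exact: measurable_sdiff.
  + exact: measurableD.
  + exact: measurable_sdiff.
  + have UnA w : U n w -> (\bigcup_n A n) w.
      by rewrite /U -bigcup_mkord => -[i _ Aiw]; exists i.
    move=> w; rewrite /sdiff /setD /setU /=; have := UnA w.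
    by have [?|?] := pselect (U n w); rewrite /V /setD /=; tauto.
- move=> v B mB; split=> [|e e0]; first exact: measurable_cylinder.
  exists [set v], [set w | B (u01 (w v))]; split.
  + exact: finite_set1.
  + exact: measurable_cylinder.
  + by move=> w w' /(_ v erefl) /= ->.
  + by rewrite /sdiff setDv setU0 measure0 lte_fin.
Qed.

End AlmostSure.

Section ZeroOne.
Variables (R : realType) (H : sgraph).
Local Notation L := (labelling R H).
Variables (P : probability L R) (hP : is_product_lebesgue P).
Local Open Scope ereal_scope.

(** Approximate [E] by an event [C] that looks at a finite set [F] only.  Choose
[r1] moving [F] off itself inside [K], then [r2] moving [F] and [r1 @` F] off
their union there.  The events [r1 C] and [r2 C] are both close to the complement of
[E], so [C] and [r1 C] are almost disjoint while [r2 C] and [r1 C] almost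
coincide.  But the permutation of vertices that agrees with [r2] on [F] and
fixes [r1 @` F] pointwise preserves the measure and turns the first
intersection into the second, so the complement of [E] is null, and so is [E]. *)
Lemma no_antisymmetric_event (D E : set L) (K : set H) :
  measurable D -> P (~` D) = 0 -> measurable E ->
  (forall F : set H, finite_set F -> exists r : H -> H,
    [/\ involutive r, forall v, ~ K v -> r v = v,
        forall v, K v -> F v -> ~ F (r v) &
        forall w, D w -> E (relabel r w) <-> ~ E w]) ->
  False.
Proof.
move=> mD PD mE flip.
have PD_eq A : measurable A -> P A = P (A `&` D).
  move=> mA; apply/eqP; rewrite eq_le; apply/andP; split.
    rewrite -[leRHS]adde0 -PD; apply: prob_subU => //;
      [exact: measurableI|exact: measurableC|].
    by move=> w Aw; have [Dw|Dw] := pselect (D w); [left|right].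
  by apply: prob_le => //; exact: measurableI.
have PEC r : involutive r -> (forall w, D w -> E (relabel r w) <-> ~ E w) ->
    P E = P (~` E).
  move=> rK rE; rewrite -(measure_relabel hP (inv_inj rK) mE).
  have mr := measurable_relabel_preimage r mE.
  apply/eqP; rewrite eq_le; apply/andP; split.
    rewrite -[leRHS]adde0 -PD; apply: prob_subU => //; try exact: measurableC.
    by move=> w /= Erw; have [Dw|Dw] := pselect (D w); [left; exact: (rE w Dw).1|right].
  rewrite -[leRHS]adde0 -PD; apply: prob_subU => //; try exact: measurableC.
  by move=> w /= Ew; have [Dw|Dw] := pselect (D w); [left; exact: (rE w Dw).2|right].
have PEC4 e : (0 < e)%R -> P (~` E) <= (e + e + (e + e))%:E.
  move=> e0.
  have [F [C [fF mC dC PC]]] := approximable_measurable P mE e0.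
  have [r1 [r1K r1K' r1F r1E]] := flip F fF.
  have [|r2 [r2K r2K' r2F r2E]] := flip (F `|` r1 @` F).
    by rewrite finite_setU; split=> //; exact: finite_image.
  (* Within [K], [r1 @` F] meets neither [F] nor its image under [r2]; outside
     [K], the maps [r1], [r2] and [p] are the identity. *)
  pose p u := if asbool (F u \/ F (r2 u)) then r2 u else u.
  have pK : involutive p.
    by move=> u; rewrite {2}/p; case: asboolP => Fu; rewrite /p; case: asboolP => //;
      rewrite ?r2K; tauto.
  pose S r := relabel r @^-1` C.
  have mS r : measurable (S r) by exact: measurable_relabel_preimage.
  have mSS r : measurable (relabel r @^-1` sdiff C E).
    by apply: measurable_relabel_preimage; exact: measurable_sdiff.
  have PSS r : involutive r -> P (relabel r @^-1` sdiff C E) < e%:E.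
    by move=> rK; rewrite (measure_relabel hP (inv_inj rK) (measurable_sdiff mC mE)).
  have swap : P (C `&` S r1) = P (S r2 `&` S r1).
    rewrite -(measure_relabel hP (inv_inj pK)); last exact: measurableI.
    rewrite preimage_setI; congr (P (_ `&` _)).
      have pF v : F v -> p v = r2 v.
        by move=> Fv; rewrite /p; case: asboolP => // -[]; left.
      by apply/seteqP; split=> w; apply: dC => v Fv; rewrite /relabel pF.
    have pF v : F v -> p (r1 v) = r1 v.
      move=> Fv; rewrite /p; case: asboolP => // Fr.
      have [Kv|nKv] := pselect (K v); last by rewrite !(r1K' v) ?r2K'.
      have Kr1 : K (r1 v).
        apply: contrapT => nK; have := r1K' _ nK; rewrite r1K => e1.
        by apply: nK; rewrite -e1.
      case: Fr => [/(r1F v Kv Fv)//|Fr2].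
      by have /not_orP[] := r2F _ Kr1 (or_intror (ex_intro2 _ _ v Fv erefl)).
    by apply/seteqP; split=> w; apply: dC => v Fv; rewrite /relabel pF.
  have mCS : measurable (C `&` S r1) by exact: measurableI.
  have mSd : measurable (sdiff C E) by exact: measurable_sdiff.
  have mrE r : measurable (relabel r @^-1` E) by exact: measurable_relabel_preimage.
  (* On [D], membership in [E] and in its relabelling by [r1] exclude each other. *)
  have up : P (C `&` S r1) <= (e + e)%:E.
    have -> : P (C `&` S r1) = P ((C `&` S r1) `&` D).
      apply: PD_eq => //.
    apply/ltW; apply: (probU_lt _ _ _ _ PC (PSS _ r1K)) => //; first exact: measurableI.
    move=> w [[Cw Srw] Dw]; have := r1E _ Dw.
    rewrite /sdiff /setU /setD /preimage /= in Srw *.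
    by have [Ew|Ew] := pselect (E w); tauto.
  (* On [D], a labelling outside [E] is relabelled into [E] by both [r1] and [r2]. *)
  have lo : P (~` E) <= P (S r2 `&` S r1) + (e + e)%:E.
    have mB : measurable (relabel r2 @^-1` sdiff C E `|` relabel r1 @^-1` sdiff C E).
      exact: measurableU.
    have mED : measurable (~` E `&` D) by apply: measurableI => //; exact: measurableC.
    have -> : P (~` E) = P (~` E `&` D).
      by apply: PD_eq; exact: measurableC.
    have Pr : P (relabel r2 @^-1` sdiff C E `|` relabel r1 @^-1` sdiff C E) <= (e + e)%:E.
      by apply: ltW; apply: (probU_lt _ _ _ _ (PSS _ r2K) (PSS _ r1K)).
    apply: (le_trans _ (leeD (lexx _) Pr)); apply: prob_subU => //.
      exact: measurableI.
    move=> w [nEw Dw]; have := r1E _ Dw; have := r2E _ Dw.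
    rewrite /sdiff /setU /setD /setI /S /preimage /=.
    by have [?|?] := pselect (C (relabel r1 w));
      have [?|?] := pselect (C (relabel r2 w)); tauto.
  apply: (le_trans lo); rewrite -swap [leRHS]EFinD; exact: leeD up (lexx _).
have PE0 : P (~` E) = 0.
  apply/eqP; rewrite eq_le measure_ge0 andbT.
  apply/lee_addgt0Pr => e e0; rewrite add0e.
  have -> : e = (e / 4 + e / 4 + (e / 4 + e / 4))%R by lra.
  by apply: PEC4; rewrite divr_gt0.
have [r [rK _ _ rE]] := flip set0 (finite_set0 _).
have := probability_setC P mE; rewrite -(PEC _ rK rE) (PEC _ rK rE) PE0 sube0.
by move/eqP; rewrite eqe eq_sym oner_eq0.
Qed.

End ZeroOne.

(** * Edges and decorations of regular bipartite graphs *)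

Lemma card_range (T : Type) k (s : 'I_k -> T) : injective s -> range s #= `I_k.
Proof.
move=> sinj; have Ik := @card_II k.
apply: card_eq_trans (_ : [set: 'I_k] #= `I_k); last by rewrite card_eq_sym.
by apply: inj_card_eq => x y _ _; exact: sinj.
Qed.

Lemma card_enum (T : Type) (S : set T) k : S #= `I_k ->
  exists s : 'I_k -> T, injective s /\ range s = S.
Proof.
move=> Sk; have /finite_set_enum[n [s [sinj sS]]] : finite_set S.
  by apply/finite_setP; exists k.
suff nk : n = k by subst n; exists s.
apply/card_eq_II; apply: card_eq_trans Sk; rewrite -sS card_eq_sym.
exact: card_range.
Qed.

Section Edges.
Variable H : sgraph.
Implicit Types (e f : edge H) (g : aut H).

Lemma edge_ext e f : sval e = sval f -> e = f.
Proof. by case: e f => [e pe] [f pf] /= ef; subst f; congr exist; exact: Prop_irrelevance. Qed.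

Definition mkedge (u v : H) (uv : adj u v) : edge H :=
  exist _ [set u; v] (ex_intro _ u (ex_intro _ v (conj uv erefl))).

Lemma incident_mkedge u v (uv : adj u v) z :
  incident z (mkedge uv) <-> z = u \/ z = v.
Proof. by []. Qed.

Lemma incident_edge e v : incident v e -> exists (u : H) (vu : adj v u), e = mkedge vu.
Proof.
have [a [b [ab eE]]] := proj2_sig e; rewrite /incident eE => -[|] /= ->.
  by exists b, ab; exact: edge_ext.
by exists a, (adj_sym ab); apply: edge_ext; rewrite eE /= setUC.
Qed.

Lemma aut_edgeK g e : aut_edge g (aut_edge (aut_inv g) e) = e.
Proof.
apply: edge_ext => /=; rewrite image_comp.
by rewrite (_ : g \o aut_inv g = id) ?image_id//; apply/funext => v /=; rewrite aut_ifunK.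
Qed.

Lemma aut_edgeVK g e : aut_edge (aut_inv g) (aut_edge g e) = e.
Proof.
apply: edge_ext => /=; rewrite image_comp.
by rewrite (_ : _ \o _ = id) ?image_id//; apply/funext => v /=; rewrite aut_funK.
Qed.

Lemma incident_aut g e v : incident (g v) (aut_edge g e) <-> incident v e.
Proof.
split; last by move=> ve; exists v.
by case=> u ue /(can_inj (aut_funK g)) <-.
Qed.

Lemma aut_mkedge g u v (uv : adj u v) (guv : adj (g u) (g v)) :
  aut_edge g (mkedge uv) = mkedge guv.
Proof. by apply: edge_ext; rewrite /= image_setU !image_set1. Qed.

Lemma mkedge_congr u v u' v' (uv : adj u v) (uv' : adj u' v') :
  u = u' -> v = v' -> mkedge uv = mkedge uv'.
Proof. by move=> uu vv; subst; exact: edge_ext. Qed.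

Lemma mkedge_sym u v (uv : adj u v) (vu : adj v u) : mkedge uv = mkedge vu.
Proof. by apply: edge_ext; rewrite /= setUC. Qed.

Lemma adj_neq u v : @adj H u v -> u <> v.
Proof. by move=> uv e; move: uv; rewrite e => /adj_irrefl. Qed.

Lemma mkedge_inj v u u' (vu : adj v u) (vu' : adj v u') :
  mkedge vu = mkedge vu' -> u = u'.
Proof.
move=> /(congr1 (fun e => incident u e)) uE.
have : incident u (mkedge vu') by rewrite -uE; right.
by case=> //= uv; case: (adj_neq vu (esym uv)).
Qed.

Lemma matched_unique (m : edge H -> bool) : is_perfect_matching m ->
  forall v e f, incident v e -> incident v f -> m e -> m f -> e = f.
Proof.
move=> pm v e f ve vf me mf; have [e0 [_ u0]] := pm v.
by rewrite -(u0 e)// -(u0 f).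
Qed.

Section Regular.
Variables (k : nat) (Hk : regular H k).

Lemma edges_at v : exists s : 'I_k -> edge H,
  injective s /\ forall e, incident v e <-> exists i, e = s i.
Proof.
have [t [tinj tE]] := card_enum (Hk v).
have vt i : adj v (t i) by rewrite -[adj _ _]/(nbrs v (t i)) -tE; exists i.
exists (fun i => mkedge (vt i)); split=> [i j /mkedge_inj/tinj//|e].
split=> [/incident_edge[u [vu ->]]|[i ->]]; last by left.
have : nbrs v u by []; rewrite -tE => -[i _ ti]; exists i.
exact: mkedge_congr.
Qed.

(** Pigeonhole: the k edges at a vertex have distinct colors among k. *)
Lemma proper_coloring_onto (c : edge H -> 'I_k) : is_proper_coloring c ->
  forall v i, exists! e, c e = i /\ incident v e.
Proof.
move=> pc v i; have [s [sinj sE]] := edges_at v.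
have vs j : incident v (s j) by apply/sE; exists j.
have cs_inj : injective (c \o s).
  move=> j l /= cjl; apply: sinj; apply: contrapT => sjl.
  exact: (pc v _ _ (vs j) (vs l) sjl cjl).
have [j ji] : exists j, c (s j) = i.
  by exists (invF cs_inj i); exact: (f_invF cs_inj i).
exists (s j); split; first by split.
move=> f [cf vf]; apply: contrapT => sjf.
by apply: (pc v _ _ (vs j) vf sjf); rewrite ji cf.
Qed.

Lemma coloring_class_matching (c : edge H -> 'I_k) (i : 'I_k) :
  is_proper_coloring c -> is_perfect_matching (fun e => c e == i).
Proof.
move=> /proper_coloring_onto pc v; have [e [[ce ve] euniq]] := pc v i.
exists e; split=> [|f [/eqP cf vf]]; last exact: euniq.
by split=> //; exact/eqP.
Qed.

End Regular.

Section Bipartite.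
Variables (A : set H) (bipA : forall u v, @adj H u v -> (A u <-> ~ A v)).

Lemma bip_edge e : exists a, A a /\ exists2 x, adj a x & sval e = [set a; x].
Proof.
have [a [b [ab ->]]] := proj2_sig e.
have [Aa|nAa] := pselect (A a); first by exists a; split=> //; exists b.
exists b; split; first by apply: contrapT => /(iffRL (bipA ab)).
by exists a; [exact: adj_sym|rewrite setUC].
Qed.

Definition aend e : H := projT1 (cid (bip_edge e)).
Definition xend e : H := projT1 (cid2 (projT2 (cid (bip_edge e))).2).

Lemma aend_side e : A (aend e).
Proof. by rewrite /aend; case: cid => /= a []. Qed.

Lemma adj_ends e : adj (aend e) (xend e).
Proof. by rewrite /xend; case: cid2. Qed.

Lemma xend_side e : ~ A (xend e).
Proof. by apply/(iffLR (bipA (adj_ends e))); exact: aend_side. Qed.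

Lemma edge_ends e : e = mkedge (adj_ends e).
Proof. by apply: edge_ext => /=; rewrite /xend /aend; case: cid2. Qed.

Lemma incident_ends e v : incident v e <-> v = aend e \/ v = xend e.
Proof. by rewrite {1}(edge_ends e). Qed.

Lemma incident_aend e v : A v -> incident v e <-> v = aend e.
Proof.
move=> Av; rewrite incident_ends; split; [case=> // vx|by left].
by case: (xend_side (e := e)); rewrite -vx.
Qed.

Lemma incident_xend e v : ~ A v -> incident v e <-> v = xend e.
Proof.
move=> Av; rewrite incident_ends; split; [case=> // vx|by right].
by case: Av; rewrite vx; exact: aend_side.
Qed.

Lemma aend_mkedge a x (ax : adj a x) : A a -> aend (mkedge ax) = a.
Proof. by move=> Aa; apply/esym/(incident_aend (mkedge ax) Aa); left. Qed.

Lemma xend_mkedge a x (ax : adj a x) : A a -> xend (mkedge ax) = x.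
Proof. by move=> Aa; apply/esym/incident_xend; [exact/(bipA ax)|right]. Qed.

Lemma aend_aut g e : (forall v, A (g v) <-> A v) -> aend (aut_edge g e) = g (aend e).
Proof.
move=> gA; apply/esym/incident_aend; first exact/gA/aend_side.
by apply/incident_aut/incident_ends; left.
Qed.

Lemma xend_aut g e : (forall v, A (g v) <-> A v) -> xend (aut_edge g e) = g (xend e).
Proof.
move=> gA; apply/esym/incident_xend; first by rewrite gA; exact: xend_side.
by apply/incident_aut/incident_ends; right.
Qed.

(** Colors below [d] point towards [A] and colors from [d] on point away from
it, so that each class mod [d] has one incoming and one outgoing edge at every
vertex. *)
Definition schreier_of_coloring d (d_gt0 : (0 < d)%N) e (i : 'I_(2 * d)) : 'I_d * H :=
  (Ordinal (ltn_pmod i d_gt0), if (i < d)%N then aend e else xend e).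

Lemma schreier_of_coloring_valid d (d_gt0 : (0 < d)%N) (c : edge H -> 'I_(2 * d)) :
  regular H (2 * d) -> is_proper_coloring c ->
  is_schreier (fun e => schreier_of_coloring d_gt0 e (c e)).
Proof.
move=> Hreg /(proper_coloring_onto Hreg) pc.
split=> [e|v i]; first by apply/incident_ends => /=; case: ifP; [left|right].
have ilt : (i < 2 * d)%N by apply: leq_trans (ltn_ord i) _; rewrite leq_pmull.
have dilt : (i + d < 2 * d)%N by rewrite mul2n -addnn ltn_add2r.
have colE (j : 'I_(2 * d)) :
    Ordinal (ltn_pmod j d_gt0) = i <-> j = Ordinal ilt \/ j = Ordinal dilt.
  split=> [/(congr1 val)/= ji|[] ->]; last first.
  - by apply: val_inj; rewrite /= modnDr modn_small.
  - by apply: val_inj; rewrite /= modn_small.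
  case: (ltnP j d) => jd; [left|right]; apply: val_inj => /=.
    by rewrite -ji modn_small.
  rewrite -ji -{2}(subnK jd) modnDr modn_small ?subnK//.
  by rewrite ltn_subLR// addnn -mul2n.
have il : (Ordinal ilt < d)%N by exact: (ltn_ord i).
have dl : (Ordinal dilt < d)%N = false by apply/negbTE; rewrite -leqNgt /= leq_addl.
have key (j : 'I_(2 * d)) (p : edge H -> Prop) :
    (forall e, p e <-> c e = j /\ incident v e) -> exists! e, p e.
  move=> pE; have [e [ce eu]] := pc v j; exists e; split; first exact/pE.
  by move=> f /pE; exact: eu.
have [Av|nAv] := pselect (A v).
- split.
  + apply: (key (Ordinal ilt)) => e /=; rewrite colE incident_aend//; split.
      case=> -[->|->]; rewrite ?il ?dl//= => ev.
      by case: (@xend_side e); rewrite ev.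
    by case=> ->; rewrite il => ->; split=> //; left.
  + apply: (key (Ordinal dilt)) => e /=; split.
      case=> /colE[->|->]; rewrite ?il ?dl; last by split.
      by move=> /incident_aend -> //.
    case=> ->; rewrite dl => ve; split=> //; first by apply/colE; right.
    by move=> xv; case: (@xend_side e); rewrite xv.
- split.
  + apply: (key (Ordinal dilt)) => e /=; rewrite colE incident_xend//; split.
      case=> -[->|->]; rewrite ?il ?dl//= => ev.
      by case: nAv; rewrite -ev; exact: aend_side.
    by case=> ->; rewrite dl => ->; split=> //; right.
  + apply: (key (Ordinal ilt)) => e /=; split.
      case=> /colE[->|->]; rewrite ?il ?dl; first by split.
      by move=> /incident_xend -> //.
    case=> ->; rewrite il => ve; split=> //; first by apply/colE; left.
    by move=> av; case: nAv; rewrite -av; exact: aend_side.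
Qed.

(** An edge of color [i] pointing to [A] is the incoming edge of its end in [A]
and the outgoing edge of its other end. *)
Lemma matching_of_schreier_valid d (i : 'I_d) (s : edge H -> 'I_d * H) :
  is_schreier s -> is_perfect_matching (fun e => `[< (s e).1 = i /\ A (s e).2 >]).
Proof.
case=> sinc sE v; have [[e1 [[e1i e1v] u1]] [e2 [[e2i e2v e2n] u2]]] := sE v i.
have [Av|nAv] := pselect (A v).
- exists e1; split; first by split; [apply/asboolP; rewrite e1v|rewrite -e1v].
  move=> f [/asboolP[fi fA] vf]; apply: u1; split=> //.
  by rewrite (iffLR (incident_aend f Av) vf); exact/incident_aend.
- exists e2; split.
    split=> //; apply/asboolP; split=> //.
    have /incident_ends[->|e2x] := sinc e2; first exact: aend_side.
    by case: e2n; rewrite e2x; apply/esym/incident_xend.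
  by move=> f [/asboolP[fi fA] vf]; apply: u2; split=> // fv; apply: nAv; rewrite -fv.
Qed.

End Bipartite.
End Edges.

Section Transfer.
Variables (R : realType) (H : sgraph) (P : probability (labelling R H) R).
Variables (T T' : decoration_type H) (h : edge H -> dvalue T -> dvalue T').
Hypothesis h_valid : forall s : edge H -> dvalue T, valid s -> valid (fun e => h e (s e)).
Hypothesis h_act : forall g e x,
  h (aut_edge g e) (dvalue_act g x) = dvalue_act g (h e x).

(** A decoration of another type computed edge by edge can keep the same domain;
measurability holds because the values of a factor are tested against arbitrary
sets. *)
Lemma transfer_is_factor D Phi : is_factor P (T := T) D Phi ->
  is_factor P (T := T') D (fun w e => h e (Phi w e)).
Proof.
case=> mD mPhi vPhi gPhi; split=> //.
- by move=> e B; exact: (mPhi e [set x | B (h e x)]).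
- by move=> w Dw; exact/h_valid/vPhi.
- move=> g w Dw; have [Dgw gw] := gPhi g w Dw; split=> //.
  apply/funext => e; rewrite gw /decoration_act.
  by rewrite -[in LHS](aut_edgeK g e) h_act aut_edgeK.
Qed.

Lemma transfer_has_factor : has_factor P T -> has_factor P T'.
Proof. by move=> [D [Phi F]]; exists D; eexists; exact: transfer_is_factor F. Qed.

Lemma transfer_has_finitary_factor : has_finitary_factor P T -> has_finitary_factor P T'.
Proof.
move=> [D [Phi [F fin]]]; exists D; eexists; split; first exact: transfer_is_factor F.
move=> x; apply: filterS (fin x) => w + Dw => /(_ Dw)[r rP]; exists r => w' Dw' ww' e xe.
by congr h; exact: rP.
Qed.

End Transfer.

(** * Balls and local rules *)

Section Balls.
Variable H : sgraph.

Lemma gball_le (x : H) r s : (r <= s)%N -> gball x r `<=` gball x s.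
Proof.
move=> /subnKC <-; elim: (s - r)%N => [|n IHn]; first by rewrite addn0.
by rewrite addnS; apply: subset_trans IHn _ => y; left.
Qed.

Lemma gball_adj (x : H) r y z : gball x r y -> adj y z -> gball x r.+1 z.
Proof. by right; exists y. Qed.

Lemma gball_center (x : H) r : gball x r x.
Proof. exact: (gball_le (leq0n r)). Qed.

Lemma gball_trans (x y : H) r s : gball x r y -> gball y s `<=` gball x (r + s).
Proof.
move=> xy; elim: s => [|s IHs] z /=; first by rewrite addn0 => ->.
by rewrite addnS => -[/IHs|[u /IHs xu uz]]; [left|right; exists u].
Qed.

Lemma finite_uniform_bound (T : Type) (S : set T) (Q : T -> nat -> Prop) :
  finite_set S -> (forall y r s, (r <= s)%N -> Q y r -> Q y s) ->
  (forall y, S y -> exists r, Q y r) -> exists r, forall y, S y -> Q y r.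
Proof.
move=> /finite_set_enum[n [s [_ <-]]] Qle Qex.
have /choice[r rP] : forall i, exists r, Q (s i) r by move=> i; apply: Qex; exists i.
exists (\max_i r i) => _ [i _ <-]; apply: Qle (rP i); exact: leq_bigmax.
Qed.

Variables (k : nat) (Hk : regular H k).

Lemma finite_gball (x : H) r : finite_set (gball x r).
Proof.
elim: r => [|r IHr]; first exact: finite_set1.
rewrite /= finite_setU; split=> //.
rewrite (_ : [set z | _] = \bigcup_(y in gball x r) nbrs y).
  by apply: bigcup_finite => // y _; apply/finite_setP; exists k.
by apply/seteqP; split=> z [y xy yz]; exists y.
Qed.

End Balls.

Section LocalRule.
Variables (R : realType) (H : sgraph) (P : probability (labelling R H) R).
Local Notation L := (labelling R H).
Variables (k : nat) (Hk : regular H k).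
Variables (D : set L) (mD : measurable D) (T T' : decoration_type H).
Variables (Phi : L -> edge H -> dvalue T) (Phi' : L -> edge H -> dvalue T').
Variables (r0 : H -> nat) (v0 : set (dvalue T)).
Hypothesis mPhi : forall e, measurable (D `&` [set w | v0 (Phi w e)]).
Hypothesis local : forall z w w', D w -> D w' ->
  (forall a b, gball z (r0 z) a -> gball z (r0 z) b ->
     u01 (w a) < u01 (w b) <-> u01 (w' a) < u01 (w' b)) ->
  (forall a b (ab : adj a b), gball z (r0 z) a -> gball z (r0 z) b ->
     v0 (Phi w (mkedge ab)) <-> v0 (Phi w' (mkedge ab))) ->
  forall e, incident z e -> Phi' w e = Phi' w' e.

(** The value at an edge is determined by the answers to finitely many
questions: the comparisons of two labels, and the membership in [v0] of the
value of [Phi] at one edge, within one ball. *)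
Lemma local_rule_measurable e B : measurable (D `&` [set w | B (Phi' w e)]).
Proof.
have [z ze] : exists z, incident z e.
  by have [u [v [_ eE]]] := proj2_sig e; exists u; rewrite /incident eE; left.
pose t (i : bool * H * H) : set L := if i.1.1 then
    [set w | u01 (w i.1.2) < u01 (w i.2)]
  else [set w | exists ab : adj i.1.2 i.2, v0 (Phi w (mkedge ab))].
apply: (measurable_finite_tests (t := t)
  (F := ([set: bool] `*` gball z (r0 z)) `*` gball z (r0 z))) => //.
- apply: finite_setX; last exact: (finite_gball Hk).
  by apply: finite_setX; [exact: finite_finset|exact: (finite_gball Hk)].
- case=> -[[] a] b; rewrite /t /=.
    by apply: measurableI => //; exact: measurable_label_lt.
  have [ab|nab] := pselect (adj a b).
    rewrite (_ : [set w | _] = [set w | v0 (Phi w (mkedge ab))]); first exact: mPhi.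
    apply/seteqP; split=> w /=; last by exists ab.
    by case=> ab'; rewrite (Prop_irrelevance ab ab').
  rewrite (_ : [set w | _] = set0); first by rewrite setI0; exact: measurable0.
  by apply/seteqP; split=> // w [].
- move=> w w' Dw Dw' tww'; apply: (local (z := z)) => // a b.
    by move=> za zb; exact: (tww' (true, a, b)).
  move=> ab za zb; have := tww' (false, a, b); rewrite /t /= => -[//|t1 t2].
  by split=> h; [have [ab'] := t1 (ex_intro _ ab h)|have [ab'] := t2 (ex_intro _ ab h)];
    rewrite (Prop_irrelevance ab ab').
Qed.

(** The values of [Phi] around the finitely many vertices of a ball depend on
bounded neighbourhoods of these vertices, all inside one larger ball. *)
Lemma local_rule_finitary : is_finitary P D Phi -> is_finitary P D Phi'.
Proof.
move=> finPhi z.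
have : {ae P, forall w, forall y, gball z (r0 z) y -> D w -> exists r, forall w', D w' ->
    (forall u, gball y r u -> w' u = w u) ->
    forall e, incident y e -> Phi w' e = Phi w e}.
  apply: ae_countable => [|y _]; last exact: finPhi.
  exact/finite_set_countable/(finite_gball Hk).
apply: filterS => w wP Dw.
have [|||r rP] := @finite_uniform_bound _ (gball z (r0 z)) (fun y r => forall w', D w' ->
    (forall u, gball y r u -> w' u = w u) ->
    forall e, incident y e -> Phi w' e = Phi w e).
- exact: (finite_gball Hk).
- move=> y r s rs yr w' Dw' ww'; apply: yr => // u yu.
  by apply: ww'; exact: gball_le yu.
- by move=> y zy; exact: wP.
exists (r0 z + r)%N => w' Dw' ww' e ze.
have ww'0 a : gball z (r0 z) a -> w' a = w a.
  by move=> za; apply: ww'; exact: gball_le (leq_addr _ _) _ za.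
apply: (local (z := z)) => // [a b za zb|a b ab za zb].
  by rewrite !ww'0.
rewrite (rP a za w' Dw')//; last by left.
by move=> u au; apply: ww'; exact: gball_trans za _ au.
Qed.

End LocalRule.

(** * The bipartite graph of edges and vertex copies *)

Section Star.
Variables (G : sgraph) (d : nat) (d_gt0 : (0 < d)%N) (G_reg : regular G (2 * d)).
Local Notation H := (star G).

Definition copy_side : set H := [set a | if a is inr _ then True else False].

Definition base (a : H) : option G := if a is inr w then Some (tag w) else None.

Lemma star_bip (u v : H) : adj u v -> (copy_side u <-> ~ copy_side v).
Proof. by case: u v => [e|a] [f|b] // _; split=> // h; case: h. Qed.

Lemma bipartite_star : bipartite H.
Proof. by exists copy_side; exact: star_bip. Qed.

Lemma half_deg (v : G) : (deg v)./2 = d.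
Proof.
suff -> : deg v = (2 * d)%N by rewrite mul2n doubleK.
rewrite /deg; case: xgetP => [k _ /= vk|/(_ (2 * d)%N)]; last by move/(_ (G_reg v)).
by apply/card_eq_II; apply: card_eq_trans (G_reg v); rewrite card_eq_sym.
Qed.

Definition copy (v : G) (i : 'I_d) : H :=
  inr (existT _ v (cast_ord (esym (half_deg v)) i)).

Lemma copy_inj v : injective (copy v).
Proof.
pose idx (a : H) : nat := if a is inr w then val (tagged w) else 0%N.
by move=> i j /(congr1 idx)/= ij; exact: val_inj.
Qed.

Lemma copyP (a : H) v : base a = Some v <-> exists i, a = copy v i.
Proof.
split=> [|[i ->]//]; case: a => // -[u i] /= [<-].
exists (cast_ord (half_deg u) i); rewrite /copy; congr (inr (existT _ _ _)).
exact: val_inj.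
Qed.

Lemma copy_sideP (a : H) : copy_side a <-> exists v, base a = Some v.
Proof. by split; case: a => [e|w] //; [exists (tag w)|case]. Qed.

Lemma adj_base (a b x : H) : copy_side a -> base a = base b -> adj a x -> adj b x.
Proof. by move: a b x => [e|[v i]] [f|[u j]] [g|w]//= _ [->]. Qed.

Lemma card_base v : [set a : H | base a = Some v] #= `I_d.
Proof.
rewrite (_ : [set a | _] = range (copy v)); first exact/card_range/copy_inj.
by apply/seteqP; split=> a; [move=> /copyP[i ->]; exists i|move=> [i _ <-]].
Qed.

Lemma star_regular : regular H (2 * d).
Proof.
case=> [e|[v i]].
  have [a [b [ab eE]]] := proj2_sig e.
  (* The first [d] indices list the copies of one end, the last [d] the other's. *)
  pose s (i : 'I_(d + d)) : H :=
    match fintype.split i with inl j => copy a j | inr j => copy b j end.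
  have sinj : injective s.
    move=> i j; rewrite -[i]fintype.splitK -[j]fintype.splitK /s !unsplitK.
    case: (fintype.split i) (fintype.split j) => [i'|i'] [j'|j'] /=.
    - by move=> /copy_inj ->.
    - by move=> /(congr1 base)[/(adj_neq ab)].
    - by move=> /(congr1 base)[/esym/(adj_neq ab)].
    - by move=> /copy_inj ->.
  rewrite (_ : nbrs _ = range s); first by rewrite mul2n -addnn; exact: card_range.
  apply/seteqP; split=> [x|_ [i _ <-]].
    case: x => // w /=; rewrite /star_adj /incident eE => -[] /= wE.
      have /copyP[j ->] : base (inr w) = Some a by rewrite /= wE.
      by exists (unsplit (inl j)) => //; rewrite /s unsplitK.
    have /copyP[j ->] : base (inr w) = Some b by rewrite /= wE.
    by exists (unsplit (inr j)) => //; rewrite /s unsplitK.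
  by rewrite /s /nbrs /=; case: (fintype.split i) => j /=; rewrite /incident eE; [left|right].
have [s [sinj sE]] := edges_at G_reg v.
rewrite (_ : nbrs _ = range (inl \o s : _ -> H)).
  by apply: card_range => j l /= [] /sinj.
apply/seteqP; split=> [[e|//] /= ve|_ [j _ <-]]; last by apply/sE; exists j.
by have /sE[j ->] := ve; exists j.
Qed.

Definition twin (K : sgraph) (a b : K) := forall x, adj a x <-> adj b x.

Lemma twin_aut (K : sgraph) (g : aut K) (a b : K) : twin a b -> twin (g a) (g b).
Proof. by move=> ab x; rewrite -(aut_ifunK g x) !aut_adj. Qed.

(** Two distinct vertices of the original graph cannot have the same incident
edges: two different edges at one of them would both join it to the other. *)
Lemma twin_base (a b : H) : copy_side a -> twin a b <-> base a = base b.
Proof.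
move=> Aa; split=> [ab|ab x]; last first.
  split; first exact: adj_base.
  by apply: adj_base; [case: a b Aa ab => // ? []|].
case: a b Aa ab => // -[v i] [f|[u j]] _ ab.
  have [s [_ sE]] := edges_at G_reg v.
  have i0 : 'I_(2 * d) by exists 0%N; rewrite muln_gt0.
  have vs : adj (inr (existT _ v i) : H) (inl (s i0)) by apply/sE; exists i0.
  by have /= := iffLR (ab _) vs.
congr Some; apply: contrapT => /= vu.
have [s [sinj sE]] := edges_at G_reg v.
have d1 : (1 < 2 * d)%N by rewrite mul2n -addnn; case: d d_gt0 => // n _; rewrite addSn addnS.
have su (l : 'I_(2 * d)) : s l = s (Ordinal (ltnW d1)).
  have e0 l' : exists uv : adj u v, s l' = mkedge uv.
    have vs : incident v (s l') by apply/sE; exists l'.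
    have us : incident u (s l') by have /= := iffLR (ab (inl (s l'))) vs.
    have [z [uz sz]] := incident_edge us; move: vs; rewrite sz => -[/= vu'|/= vz].
      by case: vu.
    have uv : adj u v by rewrite vz.
    by exists uv; exact: mkedge_congr.
  have [uv ->] := e0 l; have [uv' ->] := e0 (Ordinal (ltnW d1)); exact: mkedge_congr.
by have /(congr1 val) := sinj _ _ (su (Ordinal d1)).
Qed.

Lemma twin_edge (e : edge G) (b : H) : twin (inl e : H) b -> b = inl e.
Proof.
have i0 : 'I_d by exists 0%N.
case: b => [f|w] eb; last first.
  have [u [v [uv eE]]] := proj2_sig e.
  have /= : adj (inl e : H) (copy u i0) by rewrite /= /incident eE; left.
  by move=> /(eb (copy u i0)).
congr inl; apply: edge_ext; apply/seteqP; split=> v ve.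
  by have /= := iffRL (eb (copy v i0)) ve.
by have /= := iffLR (eb (copy v i0)) ve.
Qed.

Section Rigid.
Hypothesis d_gt1 : (1 < d)%N.

Lemma other_copy (i : 'I_d) : exists j : 'I_d, j <> i.
Proof.
pose z := Ordinal d_gt0; pose o := Ordinal d_gt1.
have [->|] := eqVneq i z; first by exists o => /(congr1 val).
by move=> /eqP iz; exists z => zi; apply: iz.
Qed.

(** For d > 1 every copy has a twin, and no vertex x_e has one. *)
Lemma aut_copy_side_sub (g : aut H) a : copy_side a -> copy_side (g a).
Proof.
move=> /copy_sideP[v /copyP[i ->]]; have [j ji] := other_copy i.
have : twin (g (copy v i)) (g (copy v j)) by apply/twin_aut/twin_base.
case gE: (g (copy v i)) => [e|//] /twin_edge; rewrite -gE.
by move=> /(can_inj (aut_funK g))/copy_inj.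
Qed.

Lemma aut_copy_side (g : aut H) a : copy_side (g a) <-> copy_side a.
Proof.
split; last exact: aut_copy_side_sub.
by move=> /(aut_copy_side_sub (aut_inv g)) /=; rewrite aut_funK.
Qed.

Lemma aut_base_sub (g : aut H) a b : copy_side a -> base a = base b -> base (g a) = base (g b).
Proof.
move=> Aa ab; apply/twin_base; first exact: aut_copy_side_sub.
by apply/twin_aut/twin_base.
Qed.

Lemma aut_base (g : aut H) a b : copy_side a -> base (g a) = base (g b) <-> base a = base b.
Proof.
move=> Aa; split; last exact: aut_base_sub.
move=> gab; have := aut_base_sub (aut_inv g) (aut_copy_side_sub g Aa) gab.
by rewrite /= !aut_funK.
Qed.

End Rigid.
End Star.

(** * Label ranks and the block coloring *)

Section Rank.
Variables (R : realType) (T : Type).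
Implicit Types (S : set T) (w : T -> unit01 R).

Definition ncard S : nat := #|` fset_set (S : set {classic T})|.

Lemma ncard_II S k : S #= `I_k -> ncard S = k.
Proof. exact: (@card_fset_set {classic T}). Qed.

Lemma ncard_lt S S' a : finite_set S' -> S `<=` S' -> S' a -> ~ S a ->
  (ncard S < ncard S')%N.
Proof.
move=> fS' SS' S'a nSa; have fS : finite_set S by exact: sub_finite_set fS'.
apply: fproper_ltn_card; rewrite fproperEneq; apply/andP; split.
  apply/eqP => /(@fset_set_inj {classic T} _ _ fS fS') SS; apply: nSa.
  by rewrite SS.
by rewrite -(@fset_set_sub {classic T})//; exact/asboolP.
Qed.

Definition rank w S (a : T) : nat := ncard [set b | S b /\ u01 (w b) < u01 (w a)].

Lemma rank_lt w S a : finite_set S -> S a -> (rank w S a < ncard S)%N.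
Proof.
by move=> fS Sa; apply: (ncard_lt (a := a)) => // [b []//|]; rewrite /= ltxx => -[].
Qed.

Lemma rank_inj w S a b : finite_set S -> injective w -> S a -> S b ->
  rank w S a = rank w S b -> a = b.
Proof.
move=> fS winj.
have lt c e : S c -> u01 (w c) < u01 (w e) -> (rank w S c < rank w S e)%N.
  move=> Sc ce; apply: (ncard_lt (a := c)).
  - by apply: sub_finite_set fS => x [].
  - by move=> x [Sx xc]; split=> //; exact: lt_trans ce.
  - by split.
  - by rewrite /= ltxx => -[].
move=> Sa Sb rab; case: (ltgtP (u01 (w a)) (u01 (w b))).
- by move=> /(lt _ _ Sa); rewrite rab ltnn.
- by move=> /(lt _ _ Sb); rewrite rab ltnn.
- by move=> /u01_inj/winj.
Qed.

Lemma rank_bij w (g h : T -> T) S S' a : cancel g h -> cancel h g -> finite_set S ->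
  (forall b, S' (g b) <-> S b) -> rank (w \o h) S' (g a) = rank w S a.
Proof.
move=> gK hK fS SS'; rewrite /rank /= gK.
set Z := [set b | S b /\ _].
have fZ : finite_set Z by apply: sub_finite_set fS => x [].
have /finite_setP[n Zn] := fZ; rewrite (ncard_II Zn); apply: ncard_II.
apply: card_eq_trans Zn; rewrite [X in X #= _](_ : _ = g @` Z).
  by apply: inj_card_eq => x y _ _; exact: (can_inj gK).
apply/seteqP; split=> b /=.
  by case=> S'b wb; exists (h b); rewrite ?hK//; split=> //; apply/SS'; rewrite hK.
by case=> c [Sc wc] <-; rewrite gK SS'.
Qed.

End Rank.

Section Matching.
Variables (G : sgraph) (d : nat) (d_gt0 : (0 < d)%N) (G_reg : regular G (2 * d)).
Local Notation H := (star G).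
Let H_reg := star_regular G_reg.
Local Notation A := (@copy_side G).
Let bipA := @star_bip G.
Local Notation aend := (aend bipA).
Local Notation xend := (xend bipA).

Let inc_x e : incident (xend e) e.
Proof. exact: iffRL (incident_ends bipA e _) (or_intror erefl). Qed.

(** The edge [x] has chosen the vertex of which [a] is a copy: the matching joins
[x] to one of its copies. *)
Definition matched_in (m : edge H -> bool) (a x : H) :=
  exists b (bx : adj b x), base b = base a /\ m (mkedge bx).

(** The set of vertices x_e in the complete bipartite block that contains the
edge from [a] to [x]; the copies in that block form [fiber a]. *)
Definition block m (a x : H) : set H :=
  [set y | adj a y /\ (matched_in m a y <-> matched_in m a x)].

Definition fiber (a : H) : set H := [set b | base b = base a].

Lemma finite_nbrs (a : H) : finite_set (nbrs a).
Proof. by apply/finite_setP; exists (2 * d)%N; exact: H_reg. Qed.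

Lemma finite_block m a x : finite_set (block m a x).
Proof. by apply: sub_finite_set (finite_nbrs a) => y []. Qed.

Lemma card_fiber (a : H) : A a -> fiber a #= `I_d.
Proof. by move=> /copy_sideP[v av]; rewrite /fiber av; exact: card_base. Qed.

Lemma finite_fiber a : A a -> finite_set (fiber a).
Proof. by move=> Aa; apply/finite_setP; exists d; exact: card_fiber. Qed.

Lemma copy_side_base (a b : H) : base a = base b -> A a -> A b.
Proof. by move=> ab /copy_sideP[v av]; apply/copy_sideP; exists v; rewrite -ab. Qed.

Variables (m : edge H -> bool) (pm : is_perfect_matching m).

(** The matching is a bijection from the d copies of a vertex to the edges that
have chosen it. *)
Lemma card_matched_in (a : H) : A a -> [set y | adj a y /\ matched_in m a y] #= `I_d.
Proof.
move=> Aa; have [s [sinj sE]] := card_enum (card_fiber Aa).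
have As i : A (s i).
  have : fiber a (s i) by rewrite -sE; exists i.
  by move=> /esym/copy_side_base; exact.
have /choice[t tP] : forall i, exists e, m e /\ incident (s i) e.
  by move=> i; have [e [eP _]] := pm (s i); exists e.
have ta i : s i = aend (t i) by have [_ /incident_aend] := tP i; exact.
rewrite [X in X #= _](_ : _ = range (xend \o t)).
  apply: card_range => i j /= xij; apply: sinj; rewrite !ta; congr aend.
  apply: (matched_unique pm (v := xend (t i))); rewrite ?(tP _).1//.
  by rewrite xij.
apply/seteqP; split=> [y [ay [b [bx [ba mb]]]]|_ [i _ <-]] /=.
  have : fiber a b by []; rewrite -sE => -[i _ sb]; exists i => //=.
  have -> : t i = mkedge bx.
    by apply: (matched_unique pm (v := s i)); [exact: (tP i).2|left|exact: (tP i).1|].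
  by apply: (xend_mkedge bipA bx); rewrite -sb; exact: As.
have bx := adj_ends bipA (t i).
have sa : fiber a (s i) by rewrite -sE; exists i.
split.
  by apply: adj_base bx; [exact: aend_side|rewrite -ta].
exists (aend (t i)), bx; split; first by rewrite -ta.
by have [+ _] := tP i; rewrite {1}(edge_ends bipA (t i)); congr (m _); exact: edge_ext.
Qed.

(** Of the 2d edges at a vertex, d have chosen it, hence d have not. *)
Lemma ncard_block a x : A a -> adj a x -> ncard (block m a x) = d.
Proof.
move=> Aa ax; have Ia := card_matched_in Aa.
have fI : finite_set [set y | adj a y /\ matched_in m a y].
  by apply/finite_setP; exists d.
have [ix|nix] := pselect (matched_in m a x).
  apply: ncard_II; rewrite [X in X #= _](_ : _ = [set y | adj a y /\ matched_in m a y])//.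
  by apply/seteqP; split=> y [ay] iy; split=> //; tauto.
rewrite /ncard (_ : block m a x = nbrs a `\` [set y | adj a y /\ matched_in m a y]).
  rewrite (@fset_setD {classic H})//; last exact: finite_nbrs.
  rewrite cardfsDS; last first.
    by rewrite -(@fset_set_sub {classic H})//; [move=> y []|exact: finite_nbrs].
  have := ncard_II Ia; have := ncard_II (H_reg a); rewrite /ncard => -> ->.
  by rewrite mul2n -addnn addnK.
apply/seteqP; split=> y.
  by case=> ay iy; split=> // -[_]; tauto.
by case=> ay iy; split=> //; split=> // iy'; case: iy.
Qed.

(** Exactly one endpoint of the edge [x] is chosen, so that the copies joined to
[x] by blocks of the same kind are copies of the same vertex. *)
Lemma same_base_of_block a b x : A a -> A b -> adj a x -> adj b x ->
  (matched_in m a x <-> matched_in m b x) -> base a = base b.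
Proof.
move=> Aa Ab ax bx abx.
have nAx : ~ A x by apply/(iffLR (bipA ax)).
have [e0 [[me0 xe0] u0]] := pm x.
have e0x : x = xend e0 by exact/incident_xend.
have cx : adj (aend e0) x by rewrite e0x; exact: adj_ends.
have inE c : A c -> matched_in m c x <-> base c = base (aend e0).
  move=> Ac; split=> [[c' [cx' [c'c mc']]]|cE].
    rewrite -c'c; congr base; apply/esym.
    have Ac' : A c' by exact: copy_side_base (esym c'c) Ac.
    rewrite -(aend_mkedge bipA cx' Ac'); congr aend.
    by apply: u0; split=> //; right.
  exists (aend e0), cx; split; first by [].
  by rewrite -[mkedge _](_ : e0 = _)//; rewrite {1}(edge_ends bipA e0); exact: mkedge_congr.
have [ia|nia] := pselect (matched_in m a x).
  by rewrite (iffLR (inE a Aa) ia); apply/esym/(inE b Ab)/abx.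
have nib : ~ matched_in m b x by rewrite -abx.
move: nia nib; rewrite !inE//.
have Ac := aend_side bipA e0; move: (aend e0) cx Ac => c cx Ac.
have [e xe] : exists e, x = inl e by case: (x) nAx => [e|w []]; first exists e.
move: ax bx cx; rewrite {}xe {abx nAx e0 me0 xe0 u0 e0x inE}.
move: a b c Aa Ab Ac => [//|[u i]] [//|[v j]] [//|[z k]] _ _ _ /=.
rewrite /star_adj /incident /=; have [p [q [_ ->]]] := proj2_sig e.
move=> /= [->|->] [->|->] [->|->] // n1 n2; (by case: n1) || (by case: n2).
Qed.

Definition block_rank (R : realType) (w : H -> unit01 R) (m : edge H -> bool) e : nat :=
  (rank w (fiber (aend e)) (aend e) + rank w (block m (aend e) (xend e)) (xend e))%N.

Lemma block_color_subproof r (b : bool) : (r %% d + (if b then 0 else d) < 2 * d)%N.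
Proof. by rewrite mul2n -addnn -addSn leq_add//; [rewrite ltn_pmod|case: b]. Qed.

(** The Latin square of sums of ranks mod [d], shifted by [d] on the blocks of
edges that have not chosen the vertex. *)
Definition block_color (R : realType) (w : H -> unit01 R) (m : edge H -> bool)
    (e : edge H) : 'I_(2 * d) :=
  Ordinal (block_color_subproof (block_rank w m e) `[< matched_in m (aend e) (xend e) >]).

Lemma block_color_eq (R : realType) (w : H -> unit01 R) e f :
  block_color w m e = block_color w m f ->
  (matched_in m (aend e) (xend e) <-> matched_in m (aend f) (xend f)) /\
  (block_rank w m e %% d)%N = (block_rank w m f %% d)%N.
Proof.
move=> /(congr1 val) /=.
have lt r : (r %% d < d)%N by rewrite ltn_pmod.
case: asboolP => ie; case: asboolP => jf; rewrite ?addn0.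
- by move=> ->; split.
- by move=> ed; have := lt (block_rank w m e); rewrite ed ltnNge leq_addl.
- by move=> ed; have := lt (block_rank w m f); rewrite -ed ltnNge leq_addl.
- by move=> /addIn ->; split.
Qed.

(** Two edges of the same color that meet lie in the same block, and there they
have the same sum of ranks mod [d] and one common end; ranks within a side of a
block are below [d] and determine the vertex. *)
Lemma block_color_proper (R : realType) (w : H -> unit01 R) : injective w ->
  is_proper_coloring (block_color w m).
Proof.
move=> winj v e f ve vf ef cef; apply: ef.
have Ae := aend_side bipA e; have Af := aend_side bipA f.
have ae := adj_ends bipA e; have af := adj_ends bipA f.
have modd (r s : nat) : (r < d)%N -> (s < d)%N -> (r %% d)%N = (s %% d)%N -> r = s.
  by move=> rd sd; rewrite !modn_small.
have ends : aend e = aend f -> xend e = xend f -> e = f.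
  move=> eA eX; rewrite (edge_ends bipA e) (edge_ends bipA f).
  exact: mkedge_congr.
have [ief ref] := block_color_eq cef.
have [Av|nAv] := pselect (A v).
- have eA : aend e = aend f.
    by rewrite -(iffLR (incident_aend bipA e Av) ve) -(iffLR (incident_aend bipA f Av) vf).
  apply: ends => //.
  have bE : block m (aend e) (xend e) = block m (aend f) (xend f).
    by move: ief; rewrite /block eA => ief; apply/seteqP; split=> y /= [ay iy];
      split=> //; tauto.
  move: ref; rewrite /block_rank bE eA => /eqP; rewrite eqn_modDl => /eqP ref.
  have xeK : block m (aend f) (xend f) (xend e).
    by move: ief ae; rewrite eA => ief ae; split.
  apply: (rank_inj (finite_block m (aend f) (xend f)) winj).
  + exact: xeK.
  + by split.
  + by apply: modd ref; rewrite -(ncard_block Af af);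
      apply: rank_lt => //; exact: finite_block.
- have eX : xend e = xend f.
    by rewrite -(iffLR (incident_xend bipA e nAv) ve) -(iffLR (incident_xend bipA f nAv) vf).
  apply: ends => //.
  have eb : base (aend e) = base (aend f).
    by apply: (same_base_of_block Ae Af ae); rewrite ?eX// -?eX//; rewrite eX in ief *.
  have fE : fiber (aend e) = fiber (aend f) by rewrite /fiber eb.
  have iE y : matched_in m (aend e) y <-> matched_in m (aend f) y.
    by split=> -[b [bx [be mb]]]; exists b, bx; rewrite be.
  have bE : block m (aend e) (xend e) = block m (aend f) (xend f).
    apply/seteqP; split=> y [ay iy].
      by split; [exact: adj_base Ae eb ay|rewrite -!iE -eX].
    by split; [exact: adj_base Af (esym eb) ay|rewrite !iE eX].
  move: ref; rewrite /block_rank bE fE eX => /eqP; rewrite eqn_modDr => /eqP ref.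
  have fd : ncard (fiber (aend f)) = d by apply: ncard_II; exact: card_fiber.
  apply: (rank_inj (finite_fiber Af) winj) => //.
  by apply: modd ref => //; rewrite -fd; apply: rank_lt => //; exact: finite_fiber.
Qed.

End Matching.

(** * Colorings from matchings for d > 1 *)

Section Swap.
Variables (K : sgraph) (a b : K) (tab : twin a b).

Definition swap (x : K) : K := if `[< x = a >] then b else if `[< x = b >] then a else x.

Lemma swapK : involutive swap.
Proof.
by move=> x; rewrite {2}/swap; case: asboolP => [->|xa];
  [|case: asboolP => [->|xb]]; rewrite /swap; do ?[case: asboolP => //].
Qed.

Lemma swap_twin x : twin (swap x) x.
Proof.
rewrite /swap; case: asboolP => [-> y|_]; first by split=> /tab.
by case: asboolP => [->|_].
Qed.

Lemma swap_adj u v : adj (swap u) (swap v) <-> adj u v.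
Proof. by rewrite swap_twin; split=> /adj_sym/swap_twin/adj_sym. Qed.

Definition swap_aut : aut K := Aut swapK swapK swap_adj.

End Swap.

Lemma full_nonempty (R : realType) (H : sgraph) (P : probability (labelling R H) R)
  (D : set (labelling R H)) : P (~` D) = 0%E -> exists w, D w.
Proof.
move=> PD; apply: contrapT => noD.
have D0 : ~` D = setT by apply/seteqP; split=> // w _ Dw; apply: noD; exists w.
by move: PD; rewrite D0 probability_setT => /eqP; rewrite eqe oner_eq0.
Qed.

Section TieBreaking.
Variables (R : realType) (G : sgraph) (d : nat) (d_gt1 : (1 < d)%N).
Hypothesis G_reg : regular G (2 * d).
Local Notation H := (star G).
Variables (P : probability (labelling R H) R) (hP : is_product_lebesgue P).
Local Notation L := (labelling R H).
Let d_gt0 : (0 < d)%N := ltnW d_gt1.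
Let H_reg := star_regular G_reg.
Let bipA := @star_bip G.

Lemma star_near_copy v i : (fun x => base x = Some v) `<=` gball (copy G_reg v i) 2.
Proof.
move=> x /(copyP G_reg)[j ->].
have [s [_ sE]] := edges_at G_reg v.
have i0 : 'I_(2 * d) by exists 0%N; rewrite muln_gt0.
have vs : incident v (s i0) by apply/sE; exists i0.
have a1 l : adj (copy G_reg v l) (inl (s i0) : H) by [].
exact: gball_adj (gball_adj (gball_center _ 0) (a1 i)) (adj_sym (a1 j)).
Qed.

(** In an uncountable graph some vertex [v] has all its copies outside the
countable set of labels that the domain looks at.  Giving these copies one label
makes the labelling, hence the matching, invariant under the exchange of two of
them, so that the partner of one is matched to both. *)
Lemma matching_factor_countable D Phi :
  is_factor P (T := perfect_matching H) D Phi -> countable [set: H].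
Proof.
case=> -[mD PD] _ vPhi gPhi.
have [S cS dS] := measurable_depends_on_countable mD.
have [covered|] := pselect (forall v, exists i, S (copy G_reg v i)).
  have cU : countable (\bigcup_(a in S) gball a 2).
    apply: bigcup_countable => // a _.
    by apply: finite_set_countable; exact: (finite_gball H_reg).
  apply: sub_countable cU; apply: subset_card_le => -[e|w] _.
    have [u [v [uv eE]]] := proj2_sig e; have [i Si] := covered u.
    exists (copy G_reg u i) => //; apply: (gball_le (r := 1%N)) => //.
    apply: gball_adj (gball_center _ _) _.
    by rewrite /= /incident eE; left.
  have [i Si] := covered (tag w); exists (copy G_reg (tag w) i) => //.
  exact: star_near_copy.
move=> /existsNP[v vS]; exfalso.
have [w Dw] := full_nonempty PD.
(* Membership in [D] is insensitive to the labels of the copies of [v]. *)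
pose w' : L := fun x => if `[< base x = Some v >] then (point : unit01 R) else w x.
have Dw' : D w'.
  apply: dS Dw => x Sx; rewrite /w'; case: asboolP => // /(copyP G_reg)[i xi].
  by case: vS; exists i; rewrite -xi.
pose i := Ordinal d_gt0; pose j := Ordinal d_gt1.
pose a : H := copy G_reg v i; pose b : H := copy G_reg v j.
have ab : a <> b by move=> /copy_inj/(congr1 val).
have tab : twin a b by apply/(twin_base d_gt0 G_reg).
pose g : aut H := swap_aut tab.
have gw : labelling_act g w' = w'.
  apply/funext => x; rewrite /labelling_act /w' /= /swap.
  by case: (asboolP (x = a)) => [->|_]; [|case: (asboolP (x = b)) => [->|_]];
    do ?[case: asboolP => //].
have pm := vPhi _ Dw'.
have [_] := gPhi g _ Dw'; rewrite gw => gE.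
have [e [[me ae] _]] := pm a.
have ge : Phi w' (aut_edge g e) = Phi w' e.
  by rewrite {1}gE /decoration_act aut_edgeVK.
have bge : incident b (aut_edge g e).
  have -> : b = g a by rewrite /= /swap; case: asboolP.
  exact/incident_aut.
have [x [ax eE]] := incident_edge ae.
have xa : x <> a by apply: nesym; exact: adj_neq ax.
have bx : adj b x by exact/tab.
have xb : x <> b by apply: nesym; exact: adj_neq bx.
have xge : incident x (aut_edge g e).
  have -> : x = g x by rewrite /= /swap; case: asboolP => //; case: asboolP.
  by apply/incident_aut; rewrite eE; right.
have ege : e = aut_edge g e.
  apply: (matched_unique pm (v := x)) => //; last by rewrite ge.
  by rewrite eE; right.
apply: ab; have Aa : copy_side a by []; have Ab : copy_side b by [].
by rewrite (iffLR (incident_aend bipA e Aa) ae) (iffLR (incident_aend bipA e Ab))// {1}ege.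
Qed.

Lemma matched_in_aut (m : edge H -> bool) (g : aut H) a y : copy_side a ->
  matched_in (decoration_act (T := perfect_matching H) g m) (g a) (g y) <->
  matched_in m a y.
Proof.
have key (m1 m2 : edge H -> bool) (h : aut H) c z : copy_side c ->
    (forall e, m1 e -> m2 (aut_edge h e)) ->
    matched_in m1 c z -> matched_in m2 (h c) (h z).
  move=> Ac m12 [b [bz [bc mb]]].
  have hbz : adj (h b) (h z) by exact/aut_adj.
  exists (h b), hbz; split; last by rewrite -(aut_mkedge bz); exact: m12.
  by apply/(aut_base d_gt0 G_reg d_gt1) => //; exact: copy_side_base (esym bc) Ac.
move=> Aa; split.
  move=> /(key _ m (aut_inv g) _ _ (aut_copy_side_sub d_gt0 G_reg d_gt1 g Aa)) /=.
  by rewrite !aut_funK; apply.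
by apply: key => // e me; rewrite /decoration_act /= aut_edgeVK.
Qed.

Lemma block_color_act (w : L) (m : edge H -> bool) (g : aut H) e :
  block_color d_gt0 (labelling_act g w) (decoration_act (T := perfect_matching H) g m)
    (aut_edge g e) = block_color d_gt0 w m e.
Proof.
have gA := aut_copy_side d_gt0 G_reg d_gt1 g.
have Ae := aend_side bipA e.
apply: val_inj; rewrite /= /block_rank !aend_aut// !xend_aut//.
set a := aend _ _; set x := xend _ _.
have -> : `[< matched_in (decoration_act (T := perfect_matching H) g m) (g a) (g x) >] =
          `[< matched_in m a x >] by apply: asbool_equiv_eq; exact: matched_in_aut.
have gwE : labelling_act g w = w \o aut_inv g by [].
congr ((_ + _) %% d + _)%N; rewrite gwE.
  apply: (rank_bij w _ (aut_funK g) (aut_ifunK g)).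
    exact: (finite_fiber G_reg Ae).
  move=> b; rewrite /fiber /=; split=> /esym ab; apply/esym.
    exact/(aut_base d_gt0 G_reg d_gt1 g b Ae).
  exact/(aut_base d_gt0 G_reg d_gt1 g b Ae).
apply: (rank_bij w _ (aut_funK g) (aut_ifunK g)).
  exact: (finite_block G_reg).
move=> b; rewrite /block /= !matched_in_aut//.
by split=> -[ab iE]; split=> //; exact/(aut_adj g a b).
Qed.

Lemma block_color_local z (w w' : L) (m m' : edge H -> bool) :
  (forall a b, gball z 2 a -> gball z 2 b ->
     u01 (w a) < u01 (w b) <-> u01 (w' a) < u01 (w' b)) ->
  (forall a b (ab : adj a b), gball z 2 a -> gball z 2 b ->
     m (mkedge ab) <-> m' (mkedge ab)) ->
  forall e, incident z e -> block_color d_gt0 w m e = block_color d_gt0 w' m' e.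
Proof.
move=> ww' mm' e ze.
have Ae := aend_side bipA e; have ax := adj_ends bipA e.
set a := aend bipA e in Ae ax *; set x := xend bipA e in ax *.
have near_nbr y : adj a y -> gball z 2 y.
  move=> ay; have [->|->] := iffLR (incident_ends bipA e z) ze.
    exact: (gball_le (ltnW (ltnSn 1))) (gball_adj (gball_center _ 0) ay).
  exact: gball_adj (gball_adj (gball_center _ 0) (adj_sym ax)) ay.
have near_fiber b : base b = base a -> gball z 2 b.
  move=> ba; have bx : adj b x by exact: adj_base Ae (esym ba) ax.
  have [->|->] := iffLR (incident_ends bipA e z) ze.
    exact: gball_adj (gball_adj (gball_center _ 0) ax) (adj_sym bx).
  exact: (gball_le (ltnW (ltnSn 1))) (gball_adj (gball_center _ 0) (adj_sym bx)).
have iE y : adj a y -> matched_in m a y <-> matched_in m' a y.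
  by move=> ay; split=> -[b [bx [ba mb]]]; exists b, bx; split=> //;
    apply/mm' => //; [exact: near_fiber|exact: near_nbr|exact: near_fiber|exact: near_nbr].
apply: val_inj => /=; rewrite /block_rank -/a -/x.
have -> : `[< matched_in m a x >] = `[< matched_in m' a x >].
  by apply: asbool_equiv_eq; exact: iE.
congr ((_ + _) %% d + _)%N; congr ncard; apply/seteqP; split=> y.
- by case=> ya lt; split=> //; apply/ww' => //; exact: near_fiber.
- by case=> ya lt; split=> //; apply/ww' => //; exact: near_fiber.
- case=> -[ay iy] lt; split; first by split=> //; rewrite -!iE.
  by apply/ww' => //; exact: near_nbr.
- case=> -[ay iy] lt; split; first by split=> //; rewrite !iE.
  by apply/ww' => //; exact: near_nbr.
Qed.

Definition block_coloring (Phi : L -> edge H -> bool) (w : L) : edge H -> 'I_(2 * d) :=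
  block_color d_gt0 w (Phi w).

Lemma block_coloring_factor D Phi : is_factor P (T := perfect_matching H) D Phi ->
  is_factor P (T := proper_coloring H (2 * d)) (D `&` @tieless R H) (block_coloring Phi) /\
  (is_finitary P (T := perfect_matching H) D Phi ->
   is_finitary P (T := proper_coloring H (2 * d)) (D `&` @tieless R H) (block_coloring Phi)).
Proof.
move=> F; have [mT PT] := tieless_full hP (matching_factor_countable F).
case: F => -[mD PD] mPhi vPhi gPhi.
have mDT : measurable (D `&` @tieless R H) by exact: measurableI.
have mPhi' e : measurable (D `&` @tieless R H `&` [set w | is_true (Phi w e)]).
  by rewrite setIAC; apply: measurableI => //; exact: mPhi.
have loc z w w' : (D `&` @tieless R H) w -> (D `&` @tieless R H) w' ->
  (forall a b, gball z 2 a -> gball z 2 b ->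
     u01 (w a) < u01 (w b) <-> u01 (w' a) < u01 (w' b)) ->
  (forall a b (ab : adj a b), gball z 2 a -> gball z 2 b ->
     is_true (Phi w (mkedge ab)) <-> is_true (Phi w' (mkedge ab))) ->
  forall e, incident z e -> block_coloring Phi w e = block_coloring Phi w' e.
  by move=> _ _; exact: block_color_local.
split; last first.
  move=> fin; apply: (local_rule_finitary (T := perfect_matching H)
    (T' := proper_coloring H (2 * d))
    (v0 := fun b : bool => is_true b) (r0 := fun=> 2%N) H_reg loc).
  move=> x; apply: filterS (fin x) => w wP [Dw _]; have [r rP] := wP Dw.
  by exists r => w' [Dw' _]; exact: rP.
split.
- split=> //; apply/eqP; rewrite eq_le measure_ge0 andbT -(adde0 0%E) -{1}PD -PT.
  apply: prob_subU; try exact: measurableC.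
  by rewrite setCI.
- move=> e B; exact: (local_rule_measurable (T := perfect_matching H)
    (T' := proper_coloring H (2 * d)) (v0 := fun b : bool => is_true b)
    (r0 := fun=> 2%N) H_reg mDT mPhi' loc).
- by move=> w [Dw tw]; apply: block_color_proper => //; exact: vPhi.
- move=> g w [Dw tw]; have [Dgw gE] := gPhi g w Dw; split.
    by split=> // x y /tw; exact: (can_inj (aut_ifunK g)).
  apply/funext => e; rewrite /block_coloring gE /decoration_act /=.
  by rewrite -[in LHS](aut_edgeK g e) block_color_act.
Qed.

Lemma coloring_factor_of_matching : has_factor P (perfect_matching H) ->
  has_factor P (proper_coloring H (2 * d)).
Proof. by move=> [D [Phi /block_coloring_factor[F _]]]; eexists; eexists; exact: F. Qed.

Lemma coloring_finitary_factor_of_matching : has_finitary_factor P (perfect_matching H) ->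
  has_finitary_factor P (proper_coloring H (2 * d)).
Proof.
move=> [D [Phi [/block_coloring_factor[F fin] /fin finF]]].
by eexists; eexists; split; [exact: F|].
Qed.

End TieBreaking.

(** * Orientations of 2-regular graphs and reflections *)

Section Orientations.
Variable H : sgraph.

(** Coherent orientations, as relations between the tail and the head of an
edge. *)
Definition is_orientation (O : H -> H -> Prop) :=
  [/\ forall u v, O u v -> adj u v,
      forall u v, adj u v -> (O u v <-> ~ O v u),
      forall u, exists! v, O u v & forall v, exists! u, O u v].

(** The same data as a coherent orientation: [s] follows it and [t] goes back. *)
Definition is_successor (s t : H -> H) :=
  [/\ cancel s t, cancel t s, forall u v, adj u v <-> v = s u \/ u = s v
    & forall u, s (s u) <> u].

Lemma orientation_successor O : is_orientation O -> exists s t, is_successor s t.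
Proof.
case=> Oadj Oanti /choice[s sP] /choice[t tP].
have ts u : t (s u) = u by apply: (tP _).2; exact: (sP u).1.
have st u : s (t u) = u by apply: (sP _).2; exact: (tP u).1.
have adj_s u : adj u (s u) by apply: Oadj; exact: (sP u).1.
exists s, t; split=> // [u v|u ssu].
  split=> [uv|[->|->]]; [|exact: adj_s|exact/adj_sym/adj_s].
  have [Ouv|nOuv] := pselect (O u v); [left|right].
    by rewrite ((sP u).2 _ Ouv).
  have Ovu : O v u by apply/(Oanti _ _ (adj_sym uv)).
  by rewrite ((sP v).2 _ Ovu).
have Osu := (sP (s u)).1; rewrite ssu in Osu.
by have /(Oanti _ _ (adj_s u))[] := (sP u).1.
Qed.

Lemma incident_unique_nbr (Q : edge H -> Prop) v :
  (exists! e, Q e /\ incident v e) -> exists! u, exists vu : adj v u, Q (mkedge vu).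
Proof.
move=> [e [[Qe ve] eu]]; have [u [vu eE]] := incident_edge ve; subst e.
exists u; split; first by exists vu.
move=> u' [vu' Q']; apply: (mkedge_inj (vu := vu) (vu' := vu')).
by apply: eu; split=> //; left.
Qed.

Lemma schreier_orientation (o : edge H -> 'I_1 * H) : is_schreier o ->
  is_orientation (fun u v => exists uv : adj u v, (o (mkedge uv)).2 = v).
Proof.
case=> oinc oU; have o1 e : (o e).1 = ord0 by rewrite (ord1 (o e).1).
split=> [u v []//|u v uv|u|v].
- split=> [[uv' h] [vu h']|nvu].
    have := h'; rewrite (mkedge_sym vu uv') h => vu'.
    exact: (adj_neq uv).
  exists uv; have /incident_mkedge[ou|//] := oinc (mkedge uv).
  by case: nvu; exists (adj_sym uv); rewrite (mkedge_sym _ uv).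
- have [_ [e [[_ ue ne] eu]]] := oU u ord0.
  have /incident_unique_nbr[v [[uv vP] vu]] :
      exists! e, (o e).2 <> u /\ incident u e.
    by exists e; split=> // f [fn uf]; apply: eu; split.
  exists v; split.
    by exists uv; have /incident_mkedge[] := oinc (mkedge uv).
  move=> v' [uv' v'P]; apply: vu; exists uv'; rewrite v'P => v'u.
  exact: (adj_neq uv').
- have [[e [[_ ev] eu]] _] := oU v ord0.
  have /incident_unique_nbr[u [[vu uP] uu]] :
      exists! e, (o e).2 = v /\ incident v e.
    by exists e; split=> [|f [fv _]]; [split=> //; rewrite -{1}ev|apply: eu; split].
  exists u; split; first by exists (adj_sym vu); rewrite (mkedge_sym _ vu).
  by move=> u' [uv' u'P]; apply: uu; exists (adj_sym uv'); rewrite (mkedge_sym _ uv').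
Qed.

Section Sides.
Variables (A : set H) (bipA : forall u v, @adj H u v -> (A u <-> ~ A v)).
Hypothesis H_reg : regular H 2.

Lemma unmatched_unique (m : edge H -> bool) v : is_perfect_matching m ->
  exists! e, ~ m e /\ incident v e.
Proof.
move=> pm; have [s [sinj sE]] := edges_at H_reg v.
have [e [[me ve] eu]] := pm v; have [i ei] := iffLR (sE e) ve.
have [j ji] : exists j : 'I_2, j <> i.
  by exists (if i == 0%N :> nat then Ordinal (ltnSn 1) else ord0) => /(congr1 val);
    case: (i) => -[|[|]].
have vs l : incident v (s l) by apply/sE; exists l.
exists (s j); split.
  split=> // msj; apply: ji; apply: sinj; rewrite -ei; apply/esym/eu; split=> //.
move=> f [nf vf]; have [l fl] := iffLR (sE f) vf.
suff -> : j = l by [].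
have li : l <> i by move=> li; apply: nf; rewrite fl li -ei.
move: ji li; case: (i) (j) (l) => -[|[|//]] ? [[|[|//]] ?] [[|[|//]] ?] ji li;
  apply: val_inj => //=; exfalso;
  (by apply: ji; exact: val_inj) || (by apply: li; exact: val_inj).
Qed.

(** In a 2-regular bipartite graph, direct the matched edges out of [A] and the
others into [A]. *)
Lemma matching_orientation (m : edge H -> bool) : is_perfect_matching m ->
  is_orientation (fun u v => exists uv : adj u v, m (mkedge uv) <-> A u).
Proof.
move=> pm.
have nbr (b : Prop) v : exists! u, exists vu : adj v u, m (mkedge vu) <-> b.
  apply: (incident_unique_nbr (Q := fun e => m e <-> b)).
  have [e [[me ve] eu]] : exists! e, (m e <-> b) /\ incident v e.
    have [hb|hb] := pselect b.
      have [e [[me ve] eu]] := pm v; exists e; split=> [|f [mf vf]]; first by split.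
      by apply: eu; split=> //; apply/mf.
    have [e [[me ve] eu]] := unmatched_unique v pm; exists e; split; first by split.
    by move=> f [mf vf]; apply: eu; split=> // /mf.
  by exists e.
split=> [u v []//|u v uv|u|v].
- split=> [[uv' h] [vu h']|nvu].
    move: h'; rewrite (mkedge_sym vu uv'); have := bipA uv.
    by have [?|?] := pselect (A v); tauto.
  exists uv; have [Au|Au] := pselect (A u); have [mu|mu] := pselect (is_true (m (mkedge uv)));
    try by split.
  + case: nvu; exists (adj_sym uv); rewrite (mkedge_sym _ uv).
    by have := iffLR (bipA uv) Au; tauto.
  + case: nvu; exists (adj_sym uv); rewrite (mkedge_sym _ uv); split=> // _.
    by apply: contrapT => /(bipA uv).
- exact: nbr.
- have [u [[vu uP] uu]] := nbr (~ A v) v; exists u; split.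
    exists (adj_sym vu); rewrite (mkedge_sym _ vu) uP.
    by have := bipA vu; have := bipA (adj_sym vu); tauto.
  move=> u' [uv' u'P]; apply: uu; exists (adj_sym uv'); rewrite (mkedge_sym _ uv') u'P.
  exact: (bipA uv').
Qed.

End Sides.
End Orientations.

Section Successor.
Variables (H : sgraph) (s t : H -> H) (st_succ : is_successor s t).

Let sK : cancel s t. Proof. by case: st_succ. Qed.
Let tK : cancel t s. Proof. by case: st_succ. Qed.

Lemma adj_succ u : adj u (s u).
Proof. by case: st_succ => _ _ sadj _; apply/sadj; left. Qed.

Lemma adj_pred u : adj u (t u).
Proof. by case: st_succ => _ _ sadj _; apply/sadj; right; rewrite tK. Qed.

Lemma adj_succ_pred u v : adj u v -> v = s u \/ v = t u.
Proof. by case: st_succ => _ _ sadj _ /sadj[->|->]; [left|right; rewrite sK]. Qed.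

Lemma succ_neq_pred u : s u <> t u.
Proof. by case: st_succ => _ _ _ ss e; apply: (ss (t u)); rewrite tK. Qed.

Lemma iterK n : cancel (iter n s) (iter n t).
Proof. by elim: n => // n IHn x; rewrite iterSr /= sK IHn. Qed.

Lemma iterVK n : cancel (iter n t) (iter n s).
Proof. by elim: n => // n IHn x; rewrite iterSr /= tK IHn. Qed.

Definition component (x : H) : set H :=
  [set y | exists n, y = iter n s x \/ y = iter n t x].

Lemma comp_refl x : component x x. Proof. by exists 0%N; left. Qed.

Lemma comp_s x y : component x y -> component x (s y).
Proof.
move=> [[|n] [->|->]]; [by exists 1%N; left|by exists 1%N; left|by exists n.+2; left|].
by exists n; right; rewrite iterS tK.
Qed.

Lemma comp_t x y : component x y -> component x (t y).
Proof.
move=> [[|n] [->|->]]; [by exists 1%N; right|by exists 1%N; right| |by exists n.+2; right].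
by exists n; left; rewrite iterS sK.
Qed.

Lemma component_ind (Q : H -> Prop) x : Q x -> (forall y, component x y -> Q y -> Q (s y)) ->
  (forall y, component x y -> Q y -> Q (t y)) -> forall y, component x y -> Q y.
Proof.
move=> Qx Qs Qt _ [n [->|->]].
  elim: n => // n IHn; apply: Qs => //; by exists n; left.
by elim: n => // n IHn; apply: Qt => //; exists n; right.
Qed.

Lemma comp_sym x y : component x y -> component y x.
Proof.
by move=> [n [->|->]]; exists n; [right; rewrite iterK|left; rewrite iterVK].
Qed.

Lemma comp_trans x y z : component x y -> component y z -> component x z.
Proof. by move=> xy; apply: component_ind => // u _; [exact: comp_s|exact: comp_t]. Qed.

Lemma comp_eq x y : component x y -> component x = component y.
Proof.
move=> xy; apply/seteqP; split=> z; last exact: comp_trans.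
exact/comp_trans/comp_sym.
Qed.

Lemma countable_comp x : countable (component x).
Proof.
apply: (@sub_countable _ _ _ ([set iter n s x | n in [set: nat]] `|`
                              [set iter n t x | n in [set: nat]])).
  by apply: subset_card_le => y [n [->|->]]; [left|right]; exists n.
rewrite -bigcup2E; apply: bigcup_countable => // -[|[|n]] _ //=;
  apply: sub_countable (card_image_le _ _) _ => //.
Qed.

Lemma finite_comp_of_period x n : (0 < n)%N -> iter n s x = x -> finite_set (component x).
Proof.
move=> n0 nx; apply: (@sub_finite_set _ _ ((fun k => iter k s x) @` `I_n)); last first.
  by apply: finite_image; exact: finite_II.
have mult k : iter (k * n) s x = x.
  by elim: k => // k IHk; rewrite mulSn iterD IHk.
have pos k : [set iter j s x | j in `I_n] (iter k s x).
  exists (k %% n)%N; first by rewrite /= ltn_mod.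
  by rewrite [in RHS](divn_eq k n) addnC iterD mult.
apply: component_ind; first exact: (pos 0%N).
  by move=> _ _ [j _ <-]; exact: (pos j.+1).
move=> _ _ [[|j] _ <-]; last by rewrite /= sK; exact: (pos j).
have -> : t x = iter n.-1 s x by rewrite -{1}nx -(prednK n0) /= sK.
exact: pos.
Qed.

(** A relation, because on a cycle a vertex is reached by several powers of
[s]; [mirror_fun] shows that they all give the same mirror image. *)
Definition mirror y z z' := exists n,
  (z = iter n s y /\ z' = iter n t y) \/ (z = iter n t y /\ z' = iter n s y).

Lemma mirror_sym y z z' : mirror y z z' -> mirror y z' z.
Proof. by move=> [n [[-> ->]|[-> ->]]]; exists n; [right|left]. Qed.

Lemma mirror_s y z z' : mirror y z z' -> mirror y (s z) (t z').
Proof.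
move=> [[|n] [[-> ->]|[-> ->]]]; try by [exists 1%N; left|exists n.+2; left].
by exists n; right; rewrite !iterS tK sK.
Qed.

Lemma mirror_t y z z' : mirror y z z' -> mirror y (t z) (s z').
Proof. by move=> /mirror_sym/mirror_s/mirror_sym. Qed.

Lemma mirror_fun y z z1 z2 : mirror y z z1 -> mirror y z z2 -> z1 = z2.
Proof.
have ss n k x : iter n s x = iter k s x -> iter n t x = iter k t x.
  move=> e; apply: (can_inj (iterK (n + k))).
  by rewrite {1}addnC !iterD !iterVK.
(* On a cycle, a vertex may be reached both forwards and backwards. *)
have mixed n k x : iter n s x = iter k t x -> iter n t x = iter k s x.
  move=> e; apply: (can_inj (iterK n)).
  by rewrite iterVK -iterD addnC iterD e iterVK.
move=> [n [[-> ->]|[-> ->]]] [k [[e ->]|[e ->]]].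
- exact: ss.
- exact: mixed.
- by apply/esym/mixed/esym.
- apply: (can_inj (iterVK (n + k))).
  by rewrite {1}addnC !iterD !iterK.
Qed.

Lemma mirror_total y z : component y z -> exists z', mirror y z z'.
Proof.
by move=> [n [->|->]]; [exists (iter n t y)|exists (iter n s y)]; exists n; [left|right].
Qed.

Lemma mirror_comp y z z' : mirror y z z' -> component y z /\ component y z'.
Proof.
by move=> [n [[-> ->]|[-> ->]]]; split; exists n; (by left) || (by right).
Qed.

Definition reflect_at y z : H :=
  if pselect (exists z', mirror y z z') is left zz then projT1 (cid zz) else z.

Lemma reflect_mirror y z z' : mirror y z z' -> reflect_at y z = z'.
Proof.
rewrite /reflect_at; case: pselect => [zz|n m]; last by case: n; exists z'.
by apply: mirror_fun; exact: projT2 (cid zz).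
Qed.

Lemma reflect_out y z : ~ component y z -> reflect_at y z = z.
Proof.
rewrite /reflect_at; case: pselect => // zz yz; case: yz.
by have [z' /mirror_comp[]] := zz.
Qed.

Lemma reflect_atK y : involutive (reflect_at y).
Proof.
move=> z; have [/mirror_total[z' zz']|yz] := pselect (component y z).
  by rewrite (reflect_mirror zz') (reflect_mirror (mirror_sym zz')).
by rewrite !reflect_out.
Qed.

Lemma reflect_adj_sub y u v : adj u v -> adj (reflect_at y u) (reflect_at y v).
Proof.
have [/mirror_total[u' uu']|yu] := pselect (component y u).
  rewrite (reflect_mirror uu') => /adj_succ_pred[|] ->.
    by rewrite (reflect_mirror (mirror_s uu')); exact: adj_pred.
  by rewrite (reflect_mirror (mirror_t uu')); exact: adj_succ.
move=> uv; have yv : ~ component y v.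
  move=> yv; apply: yu; have [->|->] := adj_succ_pred (adj_sym uv).
    exact: comp_s.
  exact: comp_t.
by rewrite !reflect_out.
Qed.

Lemma reflect_adj y u v : adj (reflect_at y u) (reflect_at y v) <-> adj u v.
Proof.
split; last exact: reflect_adj_sub.
by move=> /(reflect_adj_sub y); rewrite !reflect_atK.
Qed.

Definition reflection y : aut H := Aut (reflect_atK y) (reflect_atK y) (reflect_adj y).

(** A vertex and its mirror image are at the same distance from the centre of
the reflection. *)
Lemma reflect_side (A : set H) (bipA : forall u v, @adj H u v -> (A u <-> ~ A v)) y z :
  A (reflect_at y z) <-> A z.
Proof.
have [yz|yz] := pselect (component y z); last by rewrite reflect_out.
have [z' zz'] := mirror_total yz; rewrite (reflect_mirror zz').
case: zz' => n zE.
have par : A (iter n s y) <-> A (iter n t y).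
  elim: n {zE} => //= n IHn.
  have := bipA _ _ (adj_succ (iter n s y)); have := bipA _ _ (adj_pred (iter n t y)).
  by have [?|?] := pselect (A (s (iter n s y)));
    have [?|?] := pselect (A (t (iter n t y))); tauto.
by case: zE => -[-> ->]; rewrite par.
Qed.

Lemma orientation_shift O u : is_orientation O -> O u (s u) <-> O (s u) (s (s u)).
Proof.
case=> Oadj Oanti Oout Oin; split=> [Ou|Osu].
  have nO : ~ O (s u) u by apply/(Oanti _ _ (adj_succ u)).
  have [v [Osv _]] := Oout (s u).
  have [<-//|vE] := adj_succ_pred (Oadj _ _ Osv).
  by case: nO; move: Osv; rewrite vE sK.
apply/(Oanti _ _ (adj_succ u)) => Osu'.
have [v [_ vu]] := Oout (s u).
by case: st_succ => _ _ _ /(_ u); apply; rewrite -(vu _ Osu) -(vu _ Osu').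
Qed.

(** A component of a 2-regular graph has only two coherent orientations, so one
edge decides whether an orientation follows [s] on the whole component. *)
Lemma orientation_comp O x y : is_orientation O -> component x y ->
  O x (s x) <-> O y (s y).
Proof.
move=> Oo; move: y; apply: component_ind => // y _ IH.
  by rewrite IH; exact: orientation_shift.
by rewrite IH; have := orientation_shift (t y) Oo; rewrite tK => ->.
Qed.

End Successor.

(** * Orientation factors force countably many finite components *)

Section OrientationFactor.
Variables (R : realType) (H : sgraph).
Variables (A : set H) (bipA : forall u v, @adj H u v -> (A u <-> ~ A v)).
Variables (P : probability (labelling R H) R) (hP : is_product_lebesgue P).
Local Notation L := (labelling R H).
Variables (D : set L) (O : L -> H -> H -> Prop).
Hypotheses (mD : measurable D) (PD : P (~` D) = 0%E).
Hypothesis mO : forall u v, measurable (D `&` [set w | O w u v]).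
Hypothesis orO : forall w, D w -> is_orientation (O w).
Hypothesis gO : forall g : aut H, (forall v, A (g v) <-> A v) -> forall w, D w ->
  D (labelling_act g w) /\ forall u v, O (labelling_act g w) (g u) (g v) <-> O w u v.

Section Flip.
Variables (s t : H -> H) (st_succ : is_successor s t).

(** The reflection exchanges [s] and [t] on the component, hence reverses the
orientation there; by equivariance it exchanges the two orientations of the
edge from [x] to [s x]. *)
Lemma reflection_flips x y w : component s t x y -> D w ->
  D (relabel (reflect_at s t y) w) /\
  (O (relabel (reflect_at s t y) w) x (s x) <-> ~ O w x (s x)).
Proof.
move=> xy Dw; have [Dg gE] := gO (g := reflection st_succ y) (reflect_side st_succ bipA y) Dw.
split; first exact: Dg.
have oP := orO Dw.
have [x' xx'] := mirror_total (comp_sym st_succ xy).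
have rx : reflect_at s t y x' = x by exact/(reflect_mirror st_succ)/mirror_sym.
have rsx : reflect_at s t y (t x') = s x.
  by apply/(reflect_mirror st_succ)/mirror_sym/(mirror_s st_succ).
have yx' := (mirror_comp xx').2.
have xtx' : component s t x (t x').
  by apply: (comp_t st_succ); exact: (comp_trans st_succ xy yx').
have := gE x' (t x'); rewrite [reflection _ _ _]rx [reflection _ _ _]rsx => ->.
have [_ Oanti _ _] := oP.
rewrite (orientation_comp st_succ oP xtx').
have [_ tK _ _] := st_succ; rewrite tK.
by apply: Oanti; exact: (adj_pred st_succ).
Qed.

(** Otherwise some component avoids the countable set of labels that the domain
looks at.  With constant labels on it the labelling is invariant under a
reflection, which reverses the orientation. *)
Lemma orientation_factor_countable : countable [set: H].
Proof.
have [S cS dS] := measurable_depends_on_countable mD.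
have [covered|] := pselect (forall x, exists2 a, S a & component s t a x).
  apply: (@sub_countable _ _ _ (\bigcup_(a in S) component s t a)).
    by apply: subset_card_le => x _; have [a Sa ax] := covered x; exists a.
  by apply: bigcup_countable => // a _; exact: countable_comp.
move=> /existsNP[x xS]; exfalso.
have [w Dw] := full_nonempty PD.
(* Membership in [D] is insensitive to the labels on the component of [x]. *)
pose w' : L := fun y => if `[< component s t x y >] then (point : unit01 R) else w y.
have Dw' : D w'.
  apply: dS Dw => a Sa; rewrite /w'; case: asboolP => // xa.
  by case: xS; exists a => //; exact: comp_sym.
have w'x : relabel (reflect_at s t x) w' = w'.
  apply/funext => y; rewrite /relabel.
  have [/mirror_total[y' yy']|xy] := pselect (component s t x y); last by rewrite reflect_out.
  rewrite (reflect_mirror st_succ yy') /w'; have [xy xy'] := mirror_comp yy'.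
  by case: asboolP => //; case: asboolP.
have [_] := reflection_flips (comp_refl s t x) Dw'; rewrite w'x.
by have [?|?] := pselect (O w' x (s x)); tauto.
Qed.

(** A coincidence between these iterates would be a period of [s] on the
component, which would then be finite. *)
Lemma infinite_comp_injective x : infinite_set (component s t x) ->
  forall i j k, (i <= k)%N -> (j <= k)%N ->
    iter k.+1 s x <> iter i s x /\ iter k.+1 s x <> iter j t x.
Proof.
have [sK tK _ _] := st_succ.
move=> infx i j k ik jk; have noper n : (0 < n)%N -> iter n s x <> x.
  by move=> n0 nx; apply: infx; exact: (finite_comp_of_period st_succ n0 nx).
split=> e.
  apply: (noper (k.+1 - i)%N); first by rewrite subn_gt0.
  apply: (can_inj (iterK st_succ i)); rewrite -iterD subnKC//; exact: leqW.
apply: (noper (j + k.+1)%N); first by rewrite addnS.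
by rewrite iterD e (iterVK st_succ).
Qed.

(** On an infinite component, reflections about remote vertices move any finite
set of its vertices off itself and exchange the two orientations. *)
Lemma orientation_factor_finite_comp x : finite_set (component s t x).
Proof.
apply: contrapT => infx.
pose E := D `&` [set w | O w x (s x)].
apply: (no_antisymmetric_event hP (K := component s t x) mD PD (mO x (s x))) => F fF.
have [] := @finite_uniform_bound _ (F `&` component s t x)
  (fun v N => exists2 i, (i <= N)%N & v = iter i s x \/ v = iter i t x).
- exact: finite_setIl.
- by move=> v n m nm [i ilen vi]; exists i => //; exact: leq_trans nm.
- by move=> v [_ [n vn]]; exists n, n.
(* The part of [F] in the component is within N steps of [x]; reflecting about
   a vertex N + 1 steps ahead sends it more than N steps ahead. *)
move=> N NP; pose y := iter N.+1 s x.
have xy : component s t x y by exists N.+1; left.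
exists (reflect_at s t y); split.
- exact: reflect_atK.
- move=> v xv; apply: reflect_out => yv; apply: xv.
  exact: (comp_trans st_succ xy yv).
- move=> v xv Fv Frv.
  have [k Nk rvE] : exists2 k, (N <= k)%N & reflect_at s t y v = iter k.+1 s x.
    have [i iN [vE|vE]] := NP v (conj Fv xv).
      have e : v = iter (N.+1 - i) t y.
        rewrite vE /y; apply: (can_inj (iterK st_succ (N.+1 - i))).
        by rewrite (iterVK st_succ) -iterD subnK// leqW.
      exists (N - i + N.+1)%N; first by rewrite addnS leqW// leq_addl.
      have -> : iter (N - i + N.+1).+1 s x = iter (N.+1 - i) s y.
        by rewrite /y -iterD -addSn subSn.
      apply: (reflect_mirror st_succ); exists (N.+1 - i)%N; right.
      by split; first exact: e.
    have e : v = iter (N.+1 + i) t y.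
      by rewrite vE /y addnC iterD (iterK st_succ).
    exists (N + i + N.+1)%N; first by rewrite -addnA leq_addr.
    have -> : iter (N + i + N.+1).+1 s x = iter (N.+1 + i) s y.
      by rewrite /y -iterD -addSn addSn.
    by apply: (reflect_mirror st_succ); exists (N.+1 + i)%N; right.
  have xrv : component s t x (reflect_at s t y v) by rewrite rvE; exists k.+1; left.
  have [j jN jE] := NP _ (conj Frv xrv).
  have jk := leq_trans jN Nk.
  have [n1 n2] := infinite_comp_injective infx jk jk.
  by case: jE; rewrite rvE.
- move=> w Dw; have [Drw flip] := reflection_flips xy Dw.
  by rewrite /setI /=; tauto.
Qed.

End Flip.

Lemma orientation_factor_rigid : countable [set: H] /\
  exists s t : H -> H, is_successor s t /\ forall x, finite_set (component s t x).
Proof.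
have [w Dw] := full_nonempty PD.
have [s [t st]] := orientation_successor (orO Dw).
split; first exact: orientation_factor_countable st.
by exists s, t; split=> // x; exact: orientation_factor_finite_comp.
Qed.

End OrientationFactor.

(** * Orienting finite components by their labels *)

Section FromScratch.
Variables (R : realType) (H : sgraph).
Variables (A : set H) (bipA : forall u v, @adj H u v -> (A u <-> ~ A v)).
Variables (P : probability (labelling R H) R) (hP : is_product_lebesgue P).
Local Notation L := (labelling R H).
Variables (s t : H -> H) (st_succ : is_successor s t).
Hypotheses (H_count : countable [set: H]) (H_fin : forall x, finite_set (component s t x)).

Let sK : cancel s t. Proof. by case: st_succ. Qed.
Let tK : cancel t s. Proof. by case: st_succ. Qed.
Local Notation component := (component s t).

Definition is_top (w : L) x m :=
  component x m /\ forall z, component x z -> u01 (w z) <= u01 (w m).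

Lemma top_exists w x : exists m, is_top w x m.
Proof.
have [n [f [_ fE]]] := finite_set_enum (H_fin x).
have [i0 _] : range f x by rewrite fE; exact: comp_refl.
case: n f fE i0 => [? ? []//|n] f fE _ _.
exists (f [arg max_(i > ord0) u01 (w (f i))]%O).
case: arg_maxP => // i _ imax; split; first by rewrite -fE; exists i.
by move=> z; rewrite -fE => -[j _ <-]; exact: imax.
Qed.

Definition top w x : H := projT1 (cid (top_exists w x)).

Lemma topP w x : is_top w x (top w x).
Proof. by rewrite /top; case: cid. Qed.

Lemma top_unique w x m : injective w -> is_top w x m -> top w x = m.
Proof.
move=> winj [xm mmax]; have [xt tmax] := topP w x.
by apply/winj/u01_inj/eqP; rewrite eq_le mmax// tmax.
Qed.

Lemma top_comp w x y : injective w -> component x y -> top w x = top w y.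
Proof.
move=> winj xy; apply: top_unique => //.
by rewrite /is_top (comp_eq st_succ xy); exact: topP.
Qed.

Definition dir w x : bool := u01 (w (t (top w x))) < u01 (w (s (top w x))).
Definition nxt w x : H := if dir w x then s x else t x.
Definition prv w x : H := if dir w x then t x else s x.

Lemma dir_comp w x y : injective w -> component x y -> dir w x = dir w y.
Proof. by move=> winj xy; rewrite /dir (top_comp winj xy). Qed.

(** The direction is constant on components, because the top vertex is. *)
Lemma nxt_successor w : injective w -> is_successor (nxt w) (prv w).
Proof.
move=> winj.
have cs x : component x (s x) by exact/(comp_s st_succ)/comp_refl.
have ct x : component x (t x) by exact/(comp_t st_succ)/comp_refl.
have ds x : dir w (s x) = dir w x by exact/esym/dir_comp.
have dt x : dir w (t x) = dir w x by exact/esym/dir_comp.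
have nK : cancel (nxt w) (prv w).
  by move=> x; rewrite /nxt /prv; case dx: (dir w x); rewrite ?ds ?dt dx ?sK ?tK.
have pK : cancel (prv w) (nxt w).
  by move=> x; rewrite /nxt /prv; case dx: (dir w x); rewrite ?ds ?dt dx ?sK ?tK.
split=> // [u v|u].
  have -> : u = nxt w v <-> v = prv w u by split=> ->.
  split=> [/(adj_succ_pred st_succ)|]; rewrite /nxt /prv; case: (dir w u); try tauto.
  - by case=> ->; [exact: (adj_succ st_succ)|exact: (adj_pred st_succ)].
  - by case=> ->; [exact: (adj_pred st_succ)|exact: (adj_succ st_succ)].
have ns : s u <> t u by exact: (succ_neq_pred st_succ).
rewrite /nxt; case du: (dir w u); rewrite ?ds ?dt du => e.
  by apply: ns; rewrite -{2}e sK.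
by apply: ns; rewrite -{1}e tK.
Qed.

Lemma aut_component (g : aut H) x y : component x y -> component (g x) (g y).
Proof.
move: y; apply: component_ind => [|z _ gz|z _ gz]; first exact: comp_refl.
  have /(iffRL (aut_adj g _ _))/(adj_succ_pred st_succ)[->|->] := adj_succ st_succ z.
    exact: (comp_s st_succ).
  exact: (comp_t st_succ).
have /(iffRL (aut_adj g _ _))/(adj_succ_pred st_succ)[->|->] := adj_pred st_succ z.
  exact: (comp_s st_succ).
exact: (comp_t st_succ).
Qed.

Lemma aut_succ_pred (g : aut H) u : g (s u) = s (g u) /\ g (t u) = t (g u) \/
  g (s u) = t (g u) /\ g (t u) = s (g u).
Proof.
have gs := iffRL (aut_adj g _ _) (adj_succ st_succ u).
have gt := iffRL (aut_adj g _ _) (adj_pred st_succ u).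
have gst : g (s u) <> g (t u).
  by move=> /(can_inj (aut_funK g)); exact: (succ_neq_pred st_succ).
have [sE|sE] := adj_succ_pred st_succ gs; have [tE|tE] := adj_succ_pred st_succ gt.
- by case: gst; rewrite sE tE.
- by left.
- by right.
- by case: gst; rewrite sE tE.
Qed.

(** If the images of [u], [s u] and [s (s u)] followed [s] at first and then
turned back, then [u] and [s (s u)] would have the same image. *)
Lemma aut_preserves_component (g : aut H) x y : component x y ->
  (g (s x) = s (g x) <-> g (s y) = s (g y)).
Proof.
have step u : g (s u) = s (g u) <-> g (s (s u)) = s (g (s u)).
  split=> [e|e].
    have [[]//|[_]] := aut_succ_pred g (s u).
    rewrite sK e => gu; case: st_succ => _ _ _ /(_ (g u)) ss.
    by case: ss.
  have [[]//|[e1 _]] := aut_succ_pred g u.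
  move: e; rewrite e1 tK => /(can_inj (aut_funK g)) ssu.
  by case: st_succ => _ _ _ /(_ u).
move: y; apply: component_ind => // z _ ->; first exact: step.
by have := step (t z); rewrite tK => ->.
Qed.

(** Along each edge both conditions change, since both the edge and its image
cross from one side to the other. *)
Lemma aut_side_component (g : aut H) x y : component x y ->
  (A (g x) <-> A (g y)) <-> (A x <-> A y).
Proof.
have step u v : adj u v -> (A (g x) <-> A (g u)) <-> (A x <-> A u) ->
    (A (g x) <-> A (g v)) <-> (A x <-> A v).
  move=> uv; have := bipA uv; have := bipA (iffRL (aut_adj g _ _) uv).
  have [?|?] := pselect (A (g v)); have [?|?] := pselect (A v);
    have [?|?] := pselect (A x); have [?|?] := pselect (A (g x)); tauto.
move: y; apply: component_ind => // z _; apply: step.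
  exact: (adj_succ st_succ).
exact: (adj_pred st_succ).
Qed.

Lemma labelling_act_inj (g : aut H) (w : L) : injective w -> injective (labelling_act g w).
Proof. by move=> winj x y /winj; exact: (can_inj (aut_ifunK g)). Qed.

Lemma top_aut (g : aut H) w x : injective w ->
  top (labelling_act g w) (g x) = g (top w x).
Proof.
move=> winj; apply: top_unique; first exact: labelling_act_inj.
have [xm mmax] := topP w x; split; first exact: aut_component.
move=> z gxz; rewrite /labelling_act /= aut_funK; apply: mmax.
by have := aut_component (aut_inv g) gxz; rewrite /= aut_funK.
Qed.

(** If the automorphism reverses [s] on the component, then it also exchanges
the two neighbours of the top vertex, so the two reversals cancel. *)
Lemma nxt_aut (g : aut H) w x : injective w ->
  nxt (labelling_act g w) (g x) = g (nxt w x).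
Proof.
move=> winj; have [xm _] := topP w x; set m := top w x in xm.
have xE := aut_preserves_component g xm.
have nst v : s v <> t v by exact: (succ_neq_pred st_succ).
rewrite /nxt /dir top_aut// -/m [RHS](fun_if (g : H -> H)).
have [[sm tm]|[sm tm]] := aut_succ_pred g m.
  rewrite -sm -tm /labelling_act /= !aut_funK.
  have [[-> ->] //|[e1 _]] := aut_succ_pred g x.
  by move/xE: sm; rewrite e1 => /esym/nst.
rewrite -sm -tm /labelling_act /= !aut_funK.
have [[e1 _]|[-> ->]] := aut_succ_pred g x.
  by move/xE: e1; rewrite sm => /esym/nst.
case: (ltgtP (u01 (w (s m))) (u01 (w (t m)))) => // /u01_inj/winj.
by move=> /nst.
Qed.

End FromScratch.

Section SuccessorHead.
Variables (H : sgraph) (A : set H) (bipA : forall u v, @adj H u v -> (A u <-> ~ A v)).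
Variables (s t : H -> H) (st_succ : is_successor s t).
Local Notation aend := (aend bipA).
Local Notation xend := (xend bipA).

Definition arrow_head (f : H -> H) e : H :=
  if `[< xend e = f (aend e) >] then xend e else aend e.

Lemma edge_arrow e : exists u (us : adj u (s u)), e = mkedge us.
Proof.
have [u [v [uv eE]]] := proj2_sig e.
have [_ _ /(_ u v)[/(_ uv) vu _] _] := st_succ.
case: vu => E; [exists u, (adj_succ st_succ u)|exists v, (adj_succ st_succ v)];
  apply: edge_ext; rewrite eE E //=.
exact: setUC.
Qed.

Lemma not_both u v : v = s u -> u <> s v.
Proof. by move=> -> e; case: st_succ => _ _ _ /(_ u); rewrite -e. Qed.

Lemma arrow_headE u (us : adj u (s u)) : arrow_head s (mkedge us) = s u.
Proof.
rewrite /arrow_head; have [Au|nAu] := pselect (A u).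
  by rewrite (aend_mkedge bipA us Au) (xend_mkedge bipA us Au); case: asboolP.
have su := adj_sym us; have As : A (s u) by apply: contrapT => /(bipA us).
rewrite (mkedge_sym us su) (aend_mkedge bipA su As) (xend_mkedge bipA su As).
by case: asboolP => // /(not_both erefl).
Qed.

Lemma successor_schreier : is_schreier (fun e => (ord0 : 'I_1, arrow_head s e)).
Proof.
have inc e : incident (arrow_head s e) e.
  by apply/(incident_ends bipA); rewrite /arrow_head; case: ifP => _; [right|left].
have [sK tK _ _] := st_succ.
split=> [//|v i]; split.
  have ts : adj (t v) (s (t v)) by exact: (adj_succ st_succ).
  exists (mkedge ts); split; first by rewrite arrow_headE tK; split=> //=; rewrite (ord1 i).
  move=> f [_ /=]; have [u [us ->]] := edge_arrow f; rewrite arrow_headE => uv.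
  by apply: mkedge_congr; rewrite ?tK// -uv sK.
have vs : adj v (s v) by exact: (adj_succ st_succ).
exists (mkedge vs); split; first split.
- by rewrite /= (ord1 i).
- by left.
- by rewrite /= arrow_headE; apply: nesym; exact: adj_neq.
move=> f [_ /=]; have [u [us ->]] := edge_arrow f; rewrite arrow_headE.
by case=> [vu|vu] nv; [apply: mkedge_congr; rewrite vu|case: nv].
Qed.

End SuccessorHead.

Section FiniteComponents.
Variables (R : realType) (H : sgraph).
Variables (A : set H) (bipA : forall u v, @adj H u v -> (A u <-> ~ A v)).
Variables (P : probability (labelling R H) R) (hP : is_product_lebesgue P).
Local Notation L := (labelling R H).
Variables (k : nat) (H_reg : regular H k).
Variables (s t : H -> H) (st_succ : is_successor s t).
Hypotheses (H_count : countable [set: H]) (H_fin : forall x, finite_set (component s t x)).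
Local Notation nxt := (@nxt R H s t H_fin).
Local Notation top := (@top R H s t H_fin).
Local Notation aend := (aend bipA).
Local Notation xend := (xend bipA).

Definition top_schreier (w : L) (e : edge H) : 'I_1 * H := (ord0, arrow_head bipA (nxt w) e).

(** An edge is matched when its tail for [nxt] lies on the same side as the top
vertex.  The tail is the end in [A] exactly when [nxt] sends that end to the
other one, which turns this condition into an equivalence that does not mention
the tail. *)
Definition top_matching (w : L) (e : edge H) : bool :=
  `[< xend e = nxt w (aend e) <-> A (top w (aend e)) >].

Let nxtS (w : L) (winj : injective w) := nxt_successor st_succ H_fin winj.

Let comp_nxt (w : L) u : component s t u (nxt w u).
Proof.
by rewrite /nxt; case: ifP => _; [apply: (comp_s st_succ)|apply: (comp_t st_succ)];
  exact: comp_refl.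
Qed.

Lemma top_matching_arrow w u (us : adj u (nxt w u)) : injective w ->
  top_matching w (mkedge us) <-> (A u <-> A (top w u)).
Proof.
move=> winj; rewrite /top_matching.
have topE : top w u = top w (nxt w u) by exact: (top_comp st_succ).
have [Au|nAu] := pselect (A u).
  rewrite (aend_mkedge bipA us Au) (xend_mkedge bipA us Au).
  by split=> [/asboolP|?]; [|apply/asboolP]; tauto.
have su := adj_sym us; have As : A (nxt w u) by apply: contrapT => /(bipA us).
rewrite (mkedge_sym us su) (aend_mkedge bipA su As) (xend_mkedge bipA su As) -topE.
have nu := not_both (nxtS winj) (u := u) erefl.
by split=> [/asboolP|?]; [|apply/asboolP]; tauto.
Qed.

Lemma top_matching_perfect w : injective w -> is_perfect_matching (top_matching w).
Proof.
move=> winj v; have nS := nxtS winj; have [nK pK _ _] := nS.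
have vn : adj v (nxt w v) := adj_succ nS v.
pose p := prv H_fin w v.
have pn : adj p (nxt w p) := adj_succ nS p.
have npv : nxt w p = v by exact: pK.
have topE : top w p = top w v by rewrite -[in RHS]npv; exact: (top_comp st_succ).
have Ap : A p <-> ~ A v by have := bipA pn; rewrite npv.
have [b|b] := pselect (A v <-> A (top w v)).
  exists (mkedge vn); split; first by split; [exact/top_matching_arrow|left].
  move=> f [mf vf]; have [u [un fE]] := edge_arrow nS f; subst f.
  have uE : top w u = top w (nxt w u) by exact: (top_comp st_succ).
  move/(top_matching_arrow un winj): mf.
  case: vf => /= [vu _|vu]; first by apply: mkedge_congr; rewrite vu.
  move=> h; exfalso; move: b h; have := bipA un; rewrite uE vu.
  by have [?|?] := pselect (A u); tauto.
exists (mkedge pn); split.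
  split; last by right; rewrite npv.
  apply/top_matching_arrow => //; rewrite topE.
  by have [?|?] := pselect (A v); have [?|?] := pselect (A (top w v)); tauto.
move=> f [mf vf]; have [u [un fE]] := edge_arrow nS f; subst f.
move/(top_matching_arrow un winj): mf.
case: vf => /= [vu h|vu _]; first by case: b; rewrite vu.
have up : p = u by rewrite /p vu nK.
by apply: mkedge_congr; rewrite up.
Qed.

Lemma top_schreier_aut (g : aut H) w e : injective w ->
  arrow_head bipA (nxt (labelling_act g w)) (aut_edge g e) = g (arrow_head bipA (nxt w) e).
Proof.
move=> winj; have nS := nxtS winj; have ngS := nxtS (labelling_act_inj (g := g) winj).
have [u [un ->]] := edge_arrow nS e.
have gun : adj (g u) (g (nxt w u)) by exact/aut_adj.
have gn := nxt_aut st_succ H_fin g u winj.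
have gun' : adj (g u) (nxt (labelling_act g w) (g u)) by rewrite gn.
rewrite (aut_mkedge un gun) (mkedge_congr gun gun')//.
by rewrite (arrow_headE bipA ngS) (arrow_headE bipA nS) gn.
Qed.

Lemma top_matching_aut (g : aut H) w e : injective w ->
  top_matching (labelling_act g w) (aut_edge g e) = top_matching w e.
Proof.
move=> winj; have nS := nxtS winj; have ginj := labelling_act_inj (g := g) winj.
have [u [un ->]] := edge_arrow nS e.
have gun : adj (g u) (g (nxt w u)) by exact/aut_adj.
have gn := nxt_aut st_succ H_fin g u winj.
have gun' : adj (g u) (nxt (labelling_act g w) (g u)) by rewrite gn.
rewrite (aut_mkedge un gun) (mkedge_congr gun gun')//.
apply/idP/idP; rewrite !top_matching_arrow// (top_aut st_succ)//.
  by move/(aut_side_component bipA st_succ g (topP H_fin w u).1).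
by move=> ?; apply/(aut_side_component bipA st_succ g (topP H_fin w u).1).
Qed.

Lemma component_radius z : exists r, component s t z `<=` gball z r.
Proof.
have [||r rP] := finite_uniform_bound (Q := fun y r => gball z r y) (H_fin z).
- by move=> y r r' rr'; exact: gball_le.
- apply: component_ind => [|y _ [r zy]|y _ [r zy]].
  + by exists 0%N.
  + by exists r.+1; apply: gball_adj zy _; exact: (adj_succ st_succ).
  + by exists r.+1; apply: gball_adj zy _; exact: (adj_pred st_succ).
by exists r.
Qed.

Definition radius z : nat := projT1 (cid (component_radius z)).

Lemma radiusP z : component s t z `<=` gball z (radius z).
Proof. by rewrite /radius; case: cid. Qed.

Lemma top_local z (w w' : L) : injective w -> injective w' ->
  (forall a b, gball z (radius z) a -> gball z (radius z) b ->
     u01 (w a) < u01 (w b) <-> u01 (w' a) < u01 (w' b)) ->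
  forall u, component s t z u -> top w u = top w' u /\ nxt w u = nxt w' u.
Proof.
move=> winj w'inj ww' u zu.
have lt a b : component s t u a -> component s t u b ->
    (u01 (w a) < u01 (w b)) = (u01 (w' a) < u01 (w' b)).
  move=> ua ub; apply/idP/idP => ?; apply/ww' => //;
    by apply: radiusP; apply: (comp_trans st_succ zu).
have tE : top w u = top w' u.
  have [ut tmax] := topP H_fin w' u; apply: top_unique => //; split=> // y uy.
  by rewrite leNgt lt// -leNgt; exact: tmax.
split=> //; rewrite /nxt /dir tE lt//; have [ut _] := topP H_fin w' u.
  exact: (comp_t st_succ).
exact: (comp_s st_succ).
Qed.

Lemma incident_component z e : incident z e -> component s t z (aend e).
Proof.
move=> /(incident_ends bipA)[->|->]; first exact: comp_refl.
have [->|->] := adj_succ_pred st_succ (adj_sym (adj_ends bipA e)).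
  by apply: (comp_s st_succ); exact: comp_refl.
by apply: (comp_t st_succ); exact: comp_refl.
Qed.

(** A rule that reads, around each vertex, only the top vertex and the direction
of its component depends on the labels of a finite component. *)
Lemma local_finitary_factor (T : decoration_type H) (Phi' : L -> edge H -> dvalue T) :
  (forall z (w w' : L), injective w -> injective w' ->
     (forall u, component s t z u -> top w u = top w' u /\ nxt w u = nxt w' u) ->
     forall e, incident z e -> Phi' w e = Phi' w' e) ->
  (forall w, injective w -> valid (Phi' w)) ->
  (forall (g : aut H) w e, injective w ->
     Phi' (labelling_act g w) (aut_edge g e) = dvalue_act g (Phi' w e)) ->
  has_finitary_factor P T.
Proof.
move=> locPhi vPhi gPhi; have [mT PT] := tieless_full hP H_count.
(* No given decoration is read: the constant one serves as input to the local
   rule. *)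
pose Phi (w : L) (e : edge H) := true.
have mPhi e : measurable (@tieless R H `&` [set w | is_true (Phi w e)]).
  rewrite (_ : [set w | _] = setT); first by rewrite setIT.
  by apply/seteqP; split.
have loc z w w' : @tieless R H w -> @tieless R H w' ->
  (forall a b, gball z (radius z) a -> gball z (radius z) b ->
     u01 (w a) < u01 (w b) <-> u01 (w' a) < u01 (w' b)) ->
  (forall a b (ab : adj a b), gball z (radius z) a -> gball z (radius z) b ->
     is_true (Phi w (mkedge ab)) <-> is_true (Phi w' (mkedge ab))) ->
  forall e, incident z e -> Phi' w e = Phi' w' e.
  by move=> tw tw' ww' _; apply: locPhi => // u; exact: top_local.
exists (@tieless R H), Phi'; split; last first.
  apply: (local_rule_finitary (T := perfect_matching H) (Phi := Phi)
    (v0 := fun b : bool => is_true b) (r0 := radius) H_reg loc).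
  by move=> x; apply: aeW => w _; exists 0%N.
split=> //.
- move=> e B; exact: (local_rule_measurable (T := perfect_matching H) (Phi := Phi)
    (v0 := fun b : bool => is_true b) (r0 := radius) H_reg mT mPhi loc).
- move=> g w tw; split; first exact: labelling_act_inj.
  apply/funext => e; rewrite /decoration_act -gPhi// aut_edgeK//.
Qed.

Lemma top_matching_finitary_factor : has_finitary_factor P (perfect_matching H).
Proof.
apply: (@local_finitary_factor (perfect_matching H) top_matching).
- move=> z w w' winj w'inj tn e ze; have [tE nE] := tn _ (incident_component ze).
  by rewrite /top_matching tE nE.
- exact: top_matching_perfect.
- by move=> g w e winj; exact: top_matching_aut.
Qed.

Lemma top_schreier_finitary_factor : has_finitary_factor P (schreier H 1).
Proof.
apply: (@local_finitary_factor (schreier H 1) top_schreier).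
- move=> z w w' winj w'inj tn e ze; have [tE nE] := tn _ (incident_component ze).
  by rewrite /top_schreier /arrow_head nE.
- by move=> w winj; exact: (successor_schreier bipA (nxtS winj)).
- by move=> g w e winj; rewrite /top_schreier top_schreier_aut.
Qed.

End FiniteComponents.

(** * The 2-regular case *)

Section TwoRegular.
Variables (R : realType) (H : sgraph).
Variables (A : set H) (bipA : forall u v, @adj H u v -> (A u <-> ~ A v)).
Variables (H_reg : regular H 2).
Variables (P : probability (labelling R H) R) (hP : is_product_lebesgue P).
Local Notation L := (labelling R H).

Lemma has_finitary_factorW (T : decoration_type H) :
  has_finitary_factor P T -> has_factor P T.
Proof. by move=> [D [Phi [F _]]]; exists D, Phi. Qed.

(** A matching is read as an orientation through the sides.  This is
equivariant under the automorphisms that preserve the sides, and the reflections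
do. *)
Lemma two_regular_factors_rigid :
  has_factor P (perfect_matching H) \/ has_factor P (schreier H 1) ->
  countable [set: H] /\
  exists s t : H -> H, is_successor s t /\ forall x, finite_set (component s t x).
Proof.
case=> -[D [Phi [[mD PD] mPhi vPhi gPhi]]].
- apply: (orientation_factor_rigid bipA hP mD PD
    (O := fun w u v => exists uv : adj u v, Phi w (mkedge uv) <-> A u)).
  + move=> u v; have [uv|nuv] := pselect (adj u v); last first.
      rewrite (_ : [set w | _] = set0); first by rewrite setI0; exact: measurable0.
      by apply/seteqP; split=> // w [].
    rewrite (_ : [set w | _] = [set w | Phi w (mkedge uv) <-> A u]).
      exact: (mPhi (mkedge uv) [set b : bool | b <-> A u]).
    apply/seteqP; split=> w /=; last by exists uv.
    by case=> uv'; rewrite (Prop_irrelevance uv uv').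
  + by move=> w /vPhi; exact: matching_orientation.
  + move=> g gA w Dw; have [Dgw gE] := gPhi g w Dw; split=> // u v.
    rewrite gE /decoration_act /=.
    split=> -[uv h].
      have uv' : adj u v by exact/(aut_adj g).
      by exists uv'; move: h; rewrite -(aut_mkedge uv' uv) aut_edgeVK gA.
    have uv' : adj (g u) (g v) by exact/aut_adj.
    by exists uv'; rewrite -(aut_mkedge uv uv') aut_edgeVK gA.
- apply: (orientation_factor_rigid bipA hP mD PD
    (O := fun w u v => exists uv : adj u v, (Phi w (mkedge uv)).2 = v)).
  + move=> u v; have [uv|nuv] := pselect (adj u v); last first.
      rewrite (_ : [set w | _] = set0); first by rewrite setI0; exact: measurable0.
      by apply/seteqP; split=> // w [].
    rewrite (_ : [set w | _] = [set w | (Phi w (mkedge uv)).2 = v]).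
      exact: (mPhi (mkedge uv) [set x : 'I_1 * H | x.2 = v]).
    apply/seteqP; split=> w /=; last by exists uv.
    by case=> uv'; rewrite (Prop_irrelevance uv uv').
  + by move=> w /vPhi; exact: schreier_orientation.
  + move=> g gA w Dw; have [Dgw gE] := gPhi g w Dw; split=> // u v.
    rewrite gE /decoration_act /=.
    split=> -[uv h].
      have uv' : adj u v by exact/(aut_adj g).
      exists uv'; move: h; rewrite -(aut_mkedge uv' uv) aut_edgeVK.
      exact: (can_inj (aut_funK g)).
    have uv' : adj (g u) (g v) by exact/aut_adj.
    by exists uv'; rewrite -(aut_mkedge uv uv') aut_edgeVK h.
Qed.

Definition coloring_of_matching (e : edge H) (b : bool) : 'I_2 :=
  if b then ord0 else ord_max.

Lemma coloring_of_matching_valid (m : edge H -> bool) : is_perfect_matching m ->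
  is_proper_coloring (fun e => coloring_of_matching e (m e)).
Proof.
move=> pm v e f ve vf ef; rewrite /coloring_of_matching.
case me: (m e); case mf: (m f) => // _; apply: ef.
  exact: (matched_unique pm ve vf).
have [e0 [_ e0u]] := unmatched_unique H_reg v pm.
by rewrite -(e0u e) ?me// -(e0u f) ?mf.
Qed.

Lemma two_regular_all_finitary :
  has_factor P (perfect_matching H) \/ has_factor P (schreier H 1) ->
  has_finitary_factor P (perfect_matching H) /\ has_finitary_factor P (schreier H 1).
Proof.
move=> /two_regular_factors_rigid[cH [s [t [st fin]]]].
by split; [exact: (top_matching_finitary_factor bipA hP H_reg st cH fin)|
  exact: (top_schreier_finitary_factor bipA hP H_reg st cH fin)].
Qed.

End TwoRegular.

(** * Edge-by-edge translations and the equivalence *)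

Section LocalTransfers.
Variables (R : realType) (H : sgraph) (P : probability (labelling R H) R).

Section Colorings.
Variables (k : nat) (H_reg : regular H k) (i : 'I_k).

Let class_h (e : edge H) (c : 'I_k) : bool := c == i.

Lemma matching_factor_of_coloring :
  (has_factor P (proper_coloring H k) -> has_factor P (perfect_matching H)) /\
  (has_finitary_factor P (proper_coloring H k) ->
   has_finitary_factor P (perfect_matching H)).
Proof.
have v := @coloring_class_matching H k H_reg _ i.
by split; [apply: (transfer_has_factor (T := proper_coloring H k)
             (T' := perfect_matching H)
             (h := class_h))|
           apply: (transfer_has_finitary_factor (T := proper_coloring H k)
             (T' := perfect_matching H)
             (h := class_h))].
Qed.

End Colorings.

Section Sides.
Variables (A : set H) (bipA : forall u v, @adj H u v -> (A u <-> ~ A v)).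
Hypothesis autA : forall (g : aut H) v, A (g v) <-> A v.

Lemma schreier_factor_of_coloring d (d_gt0 : (0 < d)%N) : regular H (2 * d) ->
  (has_factor P (proper_coloring H (2 * d)) -> has_factor P (schreier H d)) /\
  (has_finitary_factor P (proper_coloring H (2 * d)) ->
   has_finitary_factor P (schreier H d)).
Proof.
move=> H_reg; pose h := schreier_of_coloring bipA d_gt0.
have h_valid : forall c : edge H -> 'I_(2 * d), is_proper_coloring c ->
    is_schreier (fun e => h e (c e)).
  by move=> c; exact: schreier_of_coloring_valid.
have h_act (g : aut H) e (c : 'I_(2 * d)) :
    h (aut_edge g e) c = ((h e c).1, g (h e c).2).
  rewrite /h /schreier_of_coloring /= aend_aut; last exact: autA.
  by rewrite xend_aut; [case: ifP|exact: autA].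
by split; [apply: (transfer_has_factor (T := proper_coloring H (2 * d))
             (T' := schreier H d)
             (h := h))|
           apply: (transfer_has_finitary_factor (T := proper_coloring H (2 * d))
             (T' := schreier H d)
             (h := h))].
Qed.

Lemma matching_factor_of_schreier d (i : 'I_d) :
  (has_factor P (schreier H d) -> has_factor P (perfect_matching H)) /\
  (has_finitary_factor P (schreier H d) -> has_finitary_factor P (perfect_matching H)).
Proof.
pose h (e : edge H) (x : 'I_d * H) : bool := `[< x.1 = i /\ A x.2 >].
have h_valid : forall o : edge H -> 'I_d * H, is_schreier o ->
    is_perfect_matching (fun e => h e (o e)).
  by move=> o; exact: matching_of_schreier_valid.
have h_act (g : aut H) e (x : 'I_d * H) : h (aut_edge g e) (x.1, g x.2) = h e x.
  by apply: asbool_equiv_eq => /=; rewrite autA.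
by split; [apply: (transfer_has_factor (T := schreier H d)
             (T' := perfect_matching H)
             (h := h))|
           apply: (transfer_has_finitary_factor (T := schreier H d)
             (T' := perfect_matching H)
             (h := h))].
Qed.

End Sides.

Lemma two_coloring_factor_of_matching : regular H 2 ->
  (has_factor P (perfect_matching H) -> has_factor P (proper_coloring H 2)) /\
  (has_finitary_factor P (perfect_matching H) ->
   has_finitary_factor P (proper_coloring H 2)).
Proof.
move=> H_reg; have h_valid := coloring_of_matching_valid H_reg.
by split; [apply: (transfer_has_factor (T := perfect_matching H)
             (T' := proper_coloring H 2)
             (h := @coloring_of_matching H))|
           apply: (transfer_has_finitary_factor (T := perfect_matching H)
             (T' := proper_coloring H 2)
             (h := @coloring_of_matching H))].
Qed.

End LocalTransfers.

Theorem proposition5 (R : realType) (d : nat) (d_gt0 : (0 < d)%N)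
    (G : sgraph) (G_reg : regular G (2 * d)) :
  bipartite (star G) /\ regular (star G) (2 * d) /\
  forall P : probability (labelling R (star G)) R, is_product_lebesgue P ->
    ((has_factor P (proper_coloring (star G) (2 * d)) <->
        has_factor P (perfect_matching (star G))) /\
     (has_factor P (perfect_matching (star G)) <->
        has_factor P (schreier (star G) d))) /\
    ((has_finitary_factor P (proper_coloring (star G) (2 * d)) <->
        has_finitary_factor P (perfect_matching (star G))) /\
     (has_finitary_factor P (perfect_matching (star G)) <->
        has_finitary_factor P (schreier (star G) d))).
Proof.
have H_reg := star_regular G_reg; have bip := @star_bip G.
split; first exact: bipartite_star.
split=> // P hP.
have c0 : (0 < 2 * d)%N by rewrite muln_gt0.
have [CM CMf] := matching_factor_of_coloring P H_reg (Ordinal c0).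
have [d_gt1|] := ltnP 1 d.
  have autA := aut_copy_side d_gt0 G_reg d_gt1.
  have [CS CSf] := schreier_factor_of_coloring P bip autA d_gt0 H_reg.
  have [SM SMf] := matching_factor_of_schreier P bip autA (Ordinal d_gt0).
  have MC := coloring_factor_of_matching d_gt1 G_reg hP.
  have MCf := coloring_finitary_factor_of_matching d_gt1 G_reg hP.
  by split; split; split=> //; [move=> /MC|move=> /MCf].
move=> d_le1; have d1 : d = 1%N by apply/eqP; rewrite eqn_leq d_le1.
subst d; have [MC MCf] := two_coloring_factor_of_matching P H_reg.
have all := two_regular_all_finitary bip H_reg hP.
split; split; split=> //.
- by move=> M; have [_ /has_finitary_factorW] := all (or_introl M).
- by move=> S; have [/has_finitary_factorW] := all (or_intror S).
- by move=> /has_finitary_factorW M; have [] := all (or_introl M).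
- by move=> /has_finitary_factorW S; have [] := all (or_intror S).
Qed.
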